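(* Let $G$ be a finite group and let $\mathcal{C}$ be a class of simple (separable) C*-algebras with the following properties: (1) if $A$ is a simple (separable) C*-algebra and $p\in A$ is a nonzero projection, then $A\in\mathcal{C}$ if and only if $pAp\in\mathcal{C}$ (in particular, this is the case if $\mathcal{C}$ is closed under Morita equivalence); (2) if $A\in\mathcal{C}$ is unital and $\alpha$ is an action of $G$ on $A$ with the tracial Rokhlin property, then $A\rtimes_{\alpha}G\in\mathcal{C}$; (3) if $A\in\mathcal{C}$ and $B$ is a C*-algebra with $A\cong B$, then $B\in\mathcal{C}$. Then $\mathcal{C}$ is closed under taking crossed products by actions of $G$ with the tracial Rokhlin property; that is, for every (not necessarily unital) $A\in\mathcal{C}$ and every action $\alpha$ of $G$ on $A$ with the tracial Rokhlin property, $A\rtimes_{\alpha}G\in\mathcal{C}$.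
   Context: The parenthetical word ''(separable)'' means that the statement holds in two versions: one with the word ''separable'' omitted throughout and one with it included throughout. For positive elements $a,b\in A$, write $a\precsim_A b$ (Cuntz subequivalence) if there is a sequence $(v_n)$ in $A$ with $\|a-v_nbv_n^*\|\to 0$. For a self-adjoint element $c$ and $\varepsilon>0$, $(c-\varepsilon)_+$ is obtained by functional calculus with $t\mapsto\max(t-\varepsilon,0)$. Tracial Rokhlin property: an action $\alpha\colon G\to\mathrm{Aut}(A)$ of a finite group $G$ on a simple (not necessarily unital) C*-algebra $A$ has the tracial Rokhlin property if for every finite subset $F\subseteq A$, every $\varepsilon>0$, and all positive elements $x,y\in A$ with $\|x\|=1$, there exists a family of mutually orthogonal projections $(p_g)_{g\in G}$ in $A$ such that, with $p=\sum_{g\in G}p_g$: (i) $\|p_ga-ap_g\|<\varepsilon$ for all $a\in F$ and $g\in G$; (ii) $\|\alpha_g(p_h)-p_{gh}\|<\varepsilon$ for all $g,h\in G$; (iii) $(y^2-ypy-\varepsilon)_+\precsim_A x$; (iv) $\|pxp\|>1-\varepsilon$. *)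

(* Defs.v *)
From HB Require Import structures.
From mathcomp Require Import all_boot all_order all_algebra all_fingroup.
From mathcomp Require Import complex.
From mathcomp Require Import all_classical all_reals all_analysis.

Set Implicit Arguments.
Unset Strict Implicit.
Unset Printing Implicit Defensive.

Import Order.TTheory GRing.Theory Num.Theory.
Import numFieldNormedType.Exports.

Local Open Scope classical_set_scope.
Local Open Scope complex_scope.
Local Open Scope ring_scope.

(* C*-algebras need not be unital, so they cannot be built on the ring types
   of the library, which all have a unit. The norm takes its values in [R[i]],
   as for every [normedModType R[i]]; these values are real and nonnegative. *)
HB.mixin Record CompleteNormedModule_isCStarAlgebra (R : realType) A
    of CompleteNormedModule R[i] A := {
  cmul : A -> A -> A;
  star : A -> A;
  cmulA : associative cmul;
  cmulDl : left_distributive cmul +%R;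
  cmulDr : right_distributive cmul +%R;
  cmulZl : forall (l : R[i]) x y, cmul (l *: x) y = l *: cmul x y;
  cmulZr : forall (l : R[i]) x y, cmul x (l *: y) = l *: cmul x y;
  starK : involutive star;
  starD : {morph star : x y / x + y};
  starZ : forall (l : R[i]) x, star (l *: x) = l^* *: star x;
  starM : forall x y, star (cmul x y) = cmul (star y) (star x);
  norm_cmul_le : forall x y, `|cmul x y| <= `|x| * `|y|;
  norm_star_cmul : forall x, `|cmul (star x) x| = `|x| ^+ 2
}.

#[short(type="cstarAlgType")]
HB.structure Definition CStarAlgebra (R : realType) :=
  {A of CompleteNormedModule R[i] A
      & CompleteNormedModule_isCStarAlgebra R A}.

Notation "x ** y" := (cmul x y) (at level 40, left associativity) : ring_scope.

Section BasicNotions.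
Variables (R : realType) (A : cstarAlgType R).
Implicit Types (a b c x y : A).

Definition unital := exists e : A, forall a, e ** a = a /\ a ** e = a.

Definition separable := exists2 D : set A, countable D & dense D.

Definition closed_ideal (I : set A) :=
  [/\ closed I, I 0,
      forall (l : R[i]) x y, I x -> I y -> I (l *: x + y),
      forall a x, I x -> I (a ** x)
    & forall a x, I x -> I (x ** a)].

Definition cstar_simple :=
  (exists a, a != 0) /\
  forall I : set A, closed_ideal I -> I = [set 0] \/ I = setT.

Definition self_adjoint a := star a = a.

Definition is_projection a := a ** a = a /\ star a = a.

(* The unitization of [A] is [A * R[i]], where [(a, l)] stands for a + l1. *)
Definition unitization_mul (u v : A * R[i]) : A * R[i] :=
  (u.1 ** v.1 + u.2 *: v.1 + v.2 *: u.1, u.2 * v.2).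

Definition unitization_invertible (u : A * R[i]) :=
  exists v, unitization_mul u v = (0, 1) /\ unitization_mul v u = (0, 1).

(* The spectrum is taken in the unitization even if [A] has a unit, in which
   case this only adds the point 0. *)
Definition spectrum a : set R[i] :=
  [set l | ~ unitization_invertible (a, - l)].

Definition positive a :=
  self_adjoint a /\ forall l, spectrum a l -> 0 <= l.

(* The value at [c] of a real polynomial without constant term (the constant
   term of [P] is ignored); [iter i (cmul c) c] is the power c^(i+1). *)
Definition poly_eval (P : {poly R}) c : A :=
  \sum_(i < (size P).-1) (P`_i.+1)%:C *: iter i (cmul c) c.

(* Continuous functional calculus, for [c] self-adjoint and [f] continuous
   with f(0) = 0: f(c) is the limit of P(c) for polynomials P with P(0) = 0
   that converge to f uniformly on the spectrum of [c], which is real. *)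
Definition is_funcalc (f : R -> R) c (d : A) :=
  forall eps : R, 0 < eps -> exists P : {poly R},
    [/\ P`_0 = 0,
        forall t : R, spectrum c t%:C -> `|P.[t] - f t| <= eps
      & `|d - poly_eval P c| <= eps%:C].

Definition funcalc (f : R -> R) c : A := xget 0 [set d | is_funcalc f c d].

(* (c - eps)_+ *)
Definition cutdown c (eps : R) : A := funcalc (fun t => Num.max (t - eps) 0) c.

Definition cuntz_le a b :=
  exists v : nat -> A, v n ** b ** star (v n) @[n --> \oo] --> a.

End BasicNotions.

Arguments unital {R} A.
Arguments separable {R} A.
Arguments cstar_simple {R} A.

Definition is_star_hom (R : realType) (A B : cstarAlgType R)
    (f : {linear A -> B}) :=
  (forall x y, f (x ** y) = f x ** f y) /\ (forall x, f (star x) = star (f x)).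

Definition cstar_iso (R : realType) (A B : cstarAlgType R) :=
  exists f : {linear A -> B}, bijective f /\ is_star_hom f.

Section Corner.
Variables (R : realType) (A : cstarAlgType R).

Record projection := Projection {
  proj_val :> A;
  projP : is_projection proj_val
}.

Variable p : projection.

(* pAp, as the set of the x with pxp = x; see [corner_pred_image]. *)
Definition corner_pred : {pred A} := fun x => p ** x ** p == x.

Lemma corner_pred_image :
  [set x | x \in corner_pred] = [set p ** a ** p | a in setT].
Proof.
have [pp _] := projP p.
apply/seteqP; split => [x /eqP xE|_ [a _ <-]] /=; first by exists x.
by apply/eqP; rewrite !cmulA pp -!cmulA pp.
Qed.

Lemma corner_submod_closed : submod_closed corner_pred.
Proof.
split; first by apply/eqP; rewrite -[0 in LHS](scale0r 0) cmulZr cmulZl !scale0r.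
move=> l x y /eqP xE /eqP yE; apply/eqP.
by rewrite cmulDr cmulDl cmulZr cmulZl xE yE.
Qed.

HB.instance Definition _ :=
  GRing.isSubmodClosed.Build R[i] A corner_pred corner_submod_closed.

Record corner := Corner { corner_val : A; _ : corner_val \in corner_pred }.

HB.instance Definition _ := [isSub for corner_val].
HB.instance Definition _ := [Choice of corner by <:].
HB.instance Definition _ := [SubChoice_isSubLmodule of corner by <:].

Definition corner_norm (x : corner) : R[i] := `|val x|.

Lemma corner_normD x y :
  corner_norm (x + y) <= corner_norm x + corner_norm y.
Proof. by rewrite /corner_norm raddfD ler_normD. Qed.

Lemma corner_normZ (l : R[i]) x : corner_norm (l *: x) = `|l| * corner_norm x.
Proof. by rewrite /corner_norm linearZ normrZ. Qed.

Lemma corner_norm0_eq0 x : corner_norm x = 0 -> x = 0.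
Proof. by move=> /normr0_eq0 x0; apply: val_inj; rewrite x0 raddf0. Qed.

HB.instance Definition _ := Lmodule_isNormed.Build R[i] corner
  corner_normD corner_normZ corner_norm0_eq0.


Lemma corner_complete (F : set_system corner) :
  ProperFilter F -> cauchy F -> cvg F.
Proof.
move=> FF Fcauchy.
have /cauchy_cvg/cvg_ex[a /cvgrPdist_lt Fa] : cauchy (corner_val @ F).
  apply: cauchy_exP => e e0.
  have [x Fx] := (cauchyP F).1 Fcauchy e e0.
  exists (val x); change (F [set y | ball (val x) e (val y)]).
  by apply: filterS Fx => y; rewrite -!ball_normE.
have pa : a \in corner_pred.
  rewrite /in_mem /= /corner_pred -subr_eq0 -normr_le0.
  set K : R[i] := `|p : A| * `|p : A| + 1.
  have K0 : 0 < K by rewrite ltr_wpDl // mulr_ge0.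
  apply/ler_addgt0Pl => e e0; rewrite addr0.
  have [x ax] : exists x : corner, `|a - val x| < e / K.
    by apply: (@filter_ex _ F); apply: Fa; rewrite divr_gt0.
  have px : p ** val x ** p = val x by apply/eqP; exact: valP x.
  have -> : p ** a ** p - a = p ** (a - val x) ** p - (a - val x).
    rewrite cmulDr cmulDl -[- val x]scaleN1r cmulZr cmulZl px scaleN1r.
    by rewrite !opprD !opprK addrACA [- val x + _]addrC subrr addr0.
  rewrite (le_trans (ler_normB _ _)) //.
  have dK : `|a - val x| * K <= e by rewrite -ler_pdivlMr // ltW.
  apply: le_trans dK; rewrite /K mulrDr mulr1 lerD2r.
  rewrite (le_trans (norm_cmul_le _ _)) // mulrA ler_wpM2r //.
  by rewrite mulrC norm_cmul_le.
apply/cvg_ex; exists (Corner pa); apply/cvgrPdist_lt => e e0.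
exact: Fa e e0.
Qed.

HB.instance Definition _ := Uniform_isComplete.Build corner corner_complete.

Lemma corner_cmul_subproof (x y : corner) : val x ** val y \in corner_pred.
Proof.
case: x y => x /eqP xE [y /eqP yE] /=; apply/eqP.
have [pp _] := projP p.
by rewrite -xE -yE !cmulA pp -!cmulA pp.
Qed.

Definition corner_cmul x y : corner := Corner (corner_cmul_subproof x y).

Lemma corner_star_subproof (x : corner) : star (val x) \in corner_pred.
Proof.
case: x => x /eqP xE /=; apply/eqP; have [_ ps] := projP p.
by rewrite -{2}xE !starM ps cmulA.
Qed.

Definition corner_star x : corner := Corner (corner_star_subproof x).

Fact corner_cmulA : associative corner_cmul.
Proof. by move=> x y z; apply: val_inj; exact: cmulA. Qed.

Fact corner_cmulDl : left_distributive corner_cmul +%R.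
Proof. by move=> x y z; apply: val_inj; exact: cmulDl. Qed.

Fact corner_cmulDr : right_distributive corner_cmul +%R.
Proof. by move=> x y z; apply: val_inj; exact: cmulDr. Qed.

Fact corner_cmulZl (l : R[i]) x y :
  corner_cmul (l *: x) y = l *: corner_cmul x y.
Proof. by apply: val_inj; exact: cmulZl. Qed.

Fact corner_cmulZr (l : R[i]) x y :
  corner_cmul x (l *: y) = l *: corner_cmul x y.
Proof. by apply: val_inj; exact: cmulZr. Qed.

Fact corner_starK : involutive corner_star.
Proof. by move=> x; apply: val_inj; exact: starK. Qed.

Fact corner_starD : {morph corner_star : x y / x + y}.
Proof. by move=> x y; apply: val_inj; exact: starD. Qed.

Fact corner_starZ (l : R[i]) x : corner_star (l *: x) = l^* *: corner_star x.
Proof. by apply: val_inj; exact: starZ. Qed.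

Fact corner_starM x y :
  corner_star (corner_cmul x y) = corner_cmul (corner_star y) (corner_star x).
Proof. by apply: val_inj; exact: starM. Qed.

Fact corner_norm_cmul_le x y : `|corner_cmul x y| <= `|x| * `|y|.
Proof. exact: norm_cmul_le. Qed.

Fact corner_norm_star_cmul x : `|corner_cmul (corner_star x) x| = `|x| ^+ 2.
Proof. exact: norm_star_cmul. Qed.

HB.instance Definition _ := CompleteNormedModule_isCStarAlgebra.Build R corner
  corner_cmulA corner_cmulDl corner_cmulDr corner_cmulZl corner_cmulZr
  corner_starK corner_starD corner_starZ corner_starM
  corner_norm_cmul_le corner_norm_star_cmul.

End Corner.

(* Each [act g] is a *-automorphism, with inverse [act g^-1]. *)
Record cstar_action (gT : finGroupType) (R : realType) (A : cstarAlgType R) :=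
  CStarAction {
    act :> gT -> {linear A -> A};
    act_star_hom : forall g, is_star_hom (act g);
    act1 : forall a, act 1%g a = a;
    actM : forall g h a, act (g * h)%g a = act g (act h a)
  }.

Section FiniteGroupActions.
Variables (gT : finGroupType) (R : realType) (A : cstarAlgType R).
Variable alpha : cstar_action gT A.

Definition tracial_rokhlin :=
  forall (F : seq A) (eps : R) (x y : A),
    0 < eps -> positive x -> positive y -> `|x| = 1 ->
  exists pr : gT -> A,
    [/\ forall g, is_projection (pr g),
        forall g h, g != h -> pr g ** pr h = 0
      & let p := \sum_g pr g in
        [/\ forall a g, a \in F -> `|pr g ** a - a ** pr g| < eps%:C,
            forall g h, `|alpha g (pr h) - pr (g * h)%g| < eps%:C,
            cuntz_le (cutdown (y ** y - y ** p ** y) eps) x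
          & `|p ** x ** p| > (1 - eps)%:C]].

(* The function [f] stands for the sum of the f(g) u_g, where the unitaries
   u_g satisfy u_g a u_g^* = alpha_g(a). *)
Definition twisted_conv (f h : {ffun gT -> A}) : {ffun gT -> A} :=
  [ffun g => \sum_k f k ** alpha k (h (k^-1 * g)%g)].

Definition twisted_star (f : {ffun gT -> A}) : {ffun gT -> A} :=
  [ffun g => alpha g (star (f (g^-1)%g))].

(* [B] is a crossed product of [A] by [alpha]. As the group is finite, the
   convolution *-algebra of all functions from it to [A] has exactly one
   C*-norm and is complete for it: the crossed product is this *-algebra with
   this norm. It is determined up to isomorphism. *)
Definition crossed_product (B : cstarAlgType R) :=
  exists j : {linear {ffun gT -> A} -> B},
    [/\ bijective j,
        forall f h, j (twisted_conv f h) = j f ** j h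
      & forall f, j (twisted_star f) = star (j f)].

End FiniteGroupActions.

(* Main.v *)
From HB Require Import structures.
Require Import Defs.
From mathcomp Require Import all_boot all_order all_algebra all_fingroup.
From mathcomp Require Import complex.
From mathcomp Require Import all_classical all_reals all_analysis.
From mathcomp Require Import ring lra.

(** The statement reduces to the unital case by cutting down with a nonzero projection [q] of
    [A] that is fixed by the action. The class contains the corner of [A] at [q] because it
    contains [A]. The action restricts to this corner with the tracial Rokhlin property
    ([corner_rokhlin]), so the class contains the crossed product of the corner, which is the
    corner of the crossed product [B] at the image of [q] ([corner_crossed_product]). As [B] is
    simple ([crossed_product_simple]), and separable when [A] is, the class contains [B].

    The projection [q] comes from the Rokhlin property itself ([invariant_projection]): the sum
    [p] of the Rokhlin projections is nonzero and almost invariant, its average over the group is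
    invariant and almost idempotent, and the projection near an almost idempotent element
    is obtained by functional calculus, which preserves invariance.

    For the Rokhlin property of the corner, the compressions of the Rokhlin projections of [A] are
    only almost projections and almost orthogonal; they are repaired one at a time
    ([near_orthogonal_projections]). The condition on Cuntz subequivalence survives the repair
    because it is asked in [A] for the element [q]. There it concerns an element close to a
    projection [E], the complement of the repaired projections, and a projection is Cuntz
    below everything close to it ([cuntz_near_projection]). For a general [y] in the corner,
    [y ** E ** y] and its cut-downs are conjugates of [E] ([cutdown_conj]).

    For the simplicity of [B], multiply an element of a nonzero ideal until its coefficient at the
    unit of the group is positive of norm one. Compressing by the Rokhlin projections and adding
    up almost kills the other coefficients ([rokhlin_average]), so that an element of [A] of
    norm near 1 lies close to the ideal. Functional calculus turns it into a nonzero element of [A]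
    inside the ideal ([ideal_meets_image]), and the simplicity of [A] does the rest.

    All this uses the continuous functional calculus of a self-adjoint element [c], which
    rests on the bound of the norm of [P(c)] by the supremum of [P] over the spectrum
    ([nrm_poly_eval_le]). It comes from three facts with direct proofs: the spectrum of [c]
    is real ([spectrum_sa_real]), polynomials map spectra to spectra ([spectrum_poly_eval]), and
    the norm of [c] or its opposite belongs to the spectrum ([spectral_radius_sa]). Bernstein
    polynomials then give the calculus for continuous functions ([weierstrass]). *)

Set Implicit Arguments.
Unset Strict Implicit.
Unset Printing Implicit Defensive.

Import Order.TTheory GRing.Theory Num.Theory.
Import numFieldNormedType.Exports.

Local Open Scope classical_set_scope.
Local Open Scope complex_scope.
Local Open Scope ring_scope.

(** * Identities in modules by ring normalization *)
Section Idealization.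
Variables (K : comNzRingType) (V : lmodType K).

(** The square-zero extension of the scalars by the module. It is commutative, so an
    identity between linear combinations of vectors can be checked in it as a
    polynomial identity, with products of vectors treated as indeterminates. *)
Definition idealization : Type := (V * K)%type.

HB.instance Definition _ := GRing.Zmodule.copy idealization (V * K)%type.

Implicit Types u v w : idealization.

Definition idealization_mul u v : idealization :=
  (u.2 *: v.1 + v.2 *: u.1, u.2 * v.2).

Fact idealization_mulA : associative idealization_mul.
Proof.
move=> [a l] [b m] [c n]; congr (_, _) => /=; last by rewrite mulrA.
by rewrite !scalerDr !scalerA addrA [n * l]mulrC [n * m]mulrC.
Qed.

Fact idealization_mulC : commutative idealization_mul.
Proof. by move=> [a l] [b m]; congr (_, _) => /=; rewrite 1?addrC 1?mulrC. Qed.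

Fact idealization_mul1 : left_id (0, 1) idealization_mul.
Proof. by move=> [a l]; congr (_, _); rewrite /= ?mul1r // scaler0 scale1r addr0. Qed.

Fact idealization_mulDl : left_distributive idealization_mul +%R.
Proof.
move=> [a l] [b m] [c n]; congr (_, _) => /=; last by rewrite mulrDl.
by rewrite scalerDl scalerDr addrACA.
Qed.

Fact idealization_1neq0 : (0, 1) != 0 :> idealization.
Proof. by rewrite xpair_eqE oner_eq0 andbF. Qed.

HB.instance Definition _ := GRing.Zmodule_isComNzRing.Build idealization
  idealization_mulA idealization_mulC idealization_mul1 idealization_mulDl
  idealization_1neq0.

Definition ring_vec (a : V) : idealization := (a, 0).
Definition ring_sca (l : K) : idealization := (0, l).

Fact ring_sca_additive : zmod_morphism ring_sca.
Proof. by move=> a b; congr (_, _); rewrite subr0. Qed.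

Fact ring_sca_multiplicative : monoid_morphism ring_sca.
Proof. by split=> // l m; congr (_, _); rewrite !scaler0 addr0. Qed.

HB.instance Definition _ :=
  GRing.isZmodMorphism.Build K idealization ring_sca ring_sca_additive.
HB.instance Definition _ :=
  GRing.isMonoidMorphism.Build K idealization ring_sca ring_sca_multiplicative.

Lemma ring_vec0 : ring_vec 0 = 0.
Proof. by []. Qed.

Lemma ring_vecD a b : ring_vec (a + b) = ring_vec a + ring_vec b.
Proof. by congr (_, _); rewrite addr0. Qed.

Lemma ring_vecN a : ring_vec (- a) = - ring_vec a.
Proof. by congr (_, _); rewrite oppr0. Qed.

Lemma ring_vecMn a n : ring_vec (a *+ n) = ring_vec a *+ n.
Proof. by elim: n => // n ih; rewrite !mulrS ring_vecD ih. Qed.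

Lemma ring_vecZ l a : ring_vec (l *: a) = ring_sca l * ring_vec a.
Proof. by congr (_, _); rewrite /= ?mulr0 // scale0r addr0. Qed.

Lemma ring_vec_inj : injective ring_vec.
Proof. by move=> a b []. Qed.

End Idealization.

Ltac module_ring :=
  apply: ring_vec_inj;
  rewrite ?(ring_vec0, ring_vecD, ring_vecN, ring_vecMn, ring_vecZ); ring.

(** * Moduli of complex numbers and norms of elements *)
Lemma expr_small (R : realType) (k e : R) : 0 <= k -> k < 1 -> 0 < e ->
  exists N, forall n, (N <= n)%N -> k ^+ n < e.
Proof.
move=> k0 k1 e0; have /cvgrPdist_lt/(_ _ e0)[N _ hN] : k ^+ n @[n --> \oo] --> 0.
  by apply: cvg_expr; rewrite ger0_norm.
exists N => n Nn; have := hN n Nn; rewrite sub0r normrN ger0_norm //.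
exact: exprn_ge0.
Qed.

Lemma invSn_small (R : realType) (e : R) : 0 < e ->
  exists N, forall n, (N <= n)%N -> n.+1%:R^-1 < e.
Proof.
move=> e0; exists (Num.truncn e^-1) => n Nn.
rewrite -[ltRHS]invrK ltf_pV2 ?posrE ?invr_gt0 //.
by apply: lt_le_trans (truncnS_gt _) _; rewrite ler_nat.
Qed.

Section ComplexModulus.
Variable R : realType.
Implicit Types (l m : R[i]) (a : R).

Definition cabs l : R := complex.Re `|l|.

Lemma cabsE l : `|l| = (cabs l)%:C.
Proof. by rewrite /cabs RRe_real // ger0_real. Qed.

Lemma cabs_ge0 l : 0 <= cabs l.
Proof. by rewrite -ler0c -cabsE. Qed.

Lemma cabsV l : cabs l^-1 = (cabs l)^-1.
Proof. by apply: complexI; rewrite -cabsE normfV cabsE fmorphV. Qed.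

Lemma cabsN l : cabs (- l) = cabs l.
Proof. by rewrite /cabs normrN. Qed.

Lemma cabsR a : cabs a%:C = `|a|.
Proof. by rewrite /cabs normc_def /= expr0n addr0 sqrtr_sqr. Qed.

Lemma cabs_Im l : `|complex.Im l| <= cabs l.
Proof.
by rewrite /cabs normc_def /= -sqrtr_sqr ler_wsqrtr // lerDr sqr_ge0.
Qed.

Lemma cabs_imag a : cabs (0 +i* a) = `|a|.
Proof. by rewrite /cabs normc_def /= expr0n add0r sqrtr_sqr. Qed.

Lemma cabs_conj l : cabs l^* = cabs l.
Proof. by rewrite /cabs norm_conjC. Qed.

Lemma conjc_real_complex a : (a%:C)^* = a%:C.
Proof. by rewrite conj_Creal // complex_real. Qed.

Lemma cabs_gt0 l : (0 < cabs l) = (l != 0).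
Proof. by rewrite -ltcR -cabsE normr_gt0. Qed.

End ComplexModulus.

Section Norm.
Variables (R : realType) (A : cstarAlgType R).
Implicit Types (x y z : A) (l : R[i]).

Lemma cmul0l x : 0 ** x = 0 :> A.
Proof. by rewrite -(scale0r (0 : A)) cmulZl !scale0r. Qed.

Lemma cmul0r x : x ** 0 = 0 :> A.
Proof. by rewrite -(scale0r (0 : A)) cmulZr !scale0r. Qed.

Lemma cmulNl x y : (- x) ** y = - (x ** y).
Proof. by rewrite -scaleN1r cmulZl scaleN1r. Qed.

Lemma cmulNr x y : x ** (- y) = - (x ** y).
Proof. by rewrite -scaleN1r cmulZr scaleN1r. Qed.

Lemma cmulBl x y z : (x - y) ** z = x ** z - y ** z.
Proof. by rewrite cmulDl cmulNl. Qed.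

Lemma cmulBr x y z : x ** (y - z) = x ** y - x ** z.
Proof. by rewrite cmulDr cmulNr. Qed.

Lemma cmul_suml (I : Type) (r : seq I) (P : pred I) (F : I -> A) x :
  (\sum_(i <- r | P i) F i) ** x = \sum_(i <- r | P i) F i ** x.
Proof. by apply: (big_morph (fun y => y ** x)) => [y z|]; rewrite ?cmulDl ?cmul0l. Qed.

Lemma cmul_sumr (I : Type) (r : seq I) (P : pred I) (F : I -> A) x :
  x ** (\sum_(i <- r | P i) F i) = \sum_(i <- r | P i) x ** F i.
Proof. by apply: (big_morph (cmul x)) => [y z|]; rewrite ?cmulDr ?cmul0r. Qed.

Lemma star0 : star 0 = 0 :> A.
Proof. by apply: (addrI (star 0)); rewrite -starD !addr0. Qed.

Lemma starN x : star (- x) = - star x.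
Proof. by rewrite -scaleN1r starZ rmorphN rmorph1 scaleN1r. Qed.

Lemma starB x y : star (x - y) = star x - star y.
Proof. by rewrite starD starN. Qed.

Lemma star_sum (I : Type) (r : seq I) (P : pred I) (F : I -> A) :
  star (\sum_(i <- r | P i) F i) = \sum_(i <- r | P i) star (F i).
Proof. by apply: (big_morph (@star R A)) => [y z|]; rewrite ?starD ?star0. Qed.

(** The given norm has complex values; this real version admits real arithmetic. *)
Definition nrm x : R := complex.Re `|x|.

Lemma nrmE x : `|x| = (nrm x)%:C.
Proof. by rewrite /nrm RRe_real // ger0_real. Qed.

Lemma nrm_ge0 x : 0 <= nrm x.
Proof. by rewrite -ler0c -nrmE. Qed.

Lemma nrm0 : nrm 0 = 0.
Proof. by apply: complexI; rewrite -nrmE normr0. Qed.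

Lemma nrm_eq0 x : nrm x = 0 -> x = 0.
Proof. by move=> x0; apply/normr0_eq0; rewrite nrmE x0. Qed.

Lemma nrm_gt0 x : x != 0 -> 0 < nrm x.
Proof.
by rewrite lt_neqAle nrm_ge0 andbT; apply: contraNneq => /esym/nrm_eq0 ->.
Qed.

Lemma nrmN x : nrm (- x) = nrm x.
Proof. by rewrite /nrm normrN. Qed.

Lemma nrm_distC x y : nrm (x - y) = nrm (y - x).
Proof. by rewrite /nrm distrC. Qed.

Lemma nrmD x y : nrm (x + y) <= nrm x + nrm y.
Proof. by rewrite -lecR rmorphD /= -!nrmE ler_normD. Qed.

Lemma nrmB x y : nrm (x - y) <= nrm x + nrm y.
Proof. by rewrite -(nrmN y) nrmD. Qed.

Lemma nrm_dist_tri z x y : nrm (x - y) <= nrm (x - z) + nrm (z - y).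
Proof. by rewrite -[x - y](subrKA z) nrmD. Qed.

Lemma nrm_sub_ge x y : nrm x - nrm y <= nrm (x - y).
Proof. by rewrite lerBlDr (le_trans _ (nrmD _ _)) // subrK. Qed.

Lemma nrmZ l x : nrm (l *: x) = cabs l * nrm x.
Proof. by apply: complexI; rewrite -nrmE normrZ nrmE cabsE rmorphM. Qed.

Lemma nrmZR (a : R) x : nrm (a%:C *: x) = `|a| * nrm x.
Proof. by rewrite nrmZ cabsR. Qed.

Lemma nrmM x y : nrm (x ** y) <= nrm x * nrm y.
Proof. by rewrite -lecR rmorphM /= -!nrmE norm_cmul_le. Qed.

Lemma nrm_mull_le x y : nrm x <= 1 -> nrm (x ** y) <= nrm y.
Proof.
by move=> x1; rewrite (le_trans (nrmM _ _)) // ler_piMl ?nrm_ge0.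
Qed.

Lemma nrm_mulr_le x y : nrm y <= 1 -> nrm (x ** y) <= nrm x.
Proof.
by move=> x1; rewrite (le_trans (nrmM _ _)) // ler_piMr ?nrm_ge0.
Qed.

Lemma nrm_star_mul x : nrm (star x ** x) = nrm x ^+ 2.
Proof. by apply: complexI; rewrite -nrmE norm_star_cmul nrmE rmorphXn. Qed.

Lemma nrm_star x : nrm (star x) = nrm x.
Proof.
have le_star y : nrm y <= nrm (star y).
  have [->|y0] := eqVneq y 0; first by rewrite star0.
  rewrite -(ler_pM2r (nrm_gt0 y0)) -expr2 -nrm_star_mul.
  exact: nrmM.
by apply/eqP; rewrite eq_le le_star -{2}(starK x) le_star.
Qed.

Lemma nrm_mul_star x : nrm (x ** star x) = nrm x ^+ 2.
Proof. by rewrite -(nrm_star x) -nrm_star_mul starK. Qed.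

Lemma mul_star_neq0 x : x != 0 -> x ** star x != 0.
Proof.
apply: contraNneq => /(congr1 nrm); rewrite nrm_mul_star nrm0 => /eqP.
by rewrite expf_eq0 => /eqP /nrm_eq0 ->.
Qed.

Lemma nrm_sum (I : Type) (r : seq I) (P : pred I) (F : I -> A) :
  nrm (\sum_(i <- r | P i) F i) <= \sum_(i <- r | P i) nrm (F i).
Proof.
elim/big_rec2: _ => [|i s t _ h]; first by rewrite nrm0.
by rewrite (le_trans (nrmD _ _)) // lerD2l.
Qed.

Lemma nrm_sum_le (I : finType) (F : I -> A) (e : R) :
  (forall i, nrm (F i) <= e) -> nrm (\sum_i F i) <= #|I|%:R * e.
Proof.
move=> Fe; rewrite (le_trans (nrm_sum _ _ _)) // mulr_natl -sumr_const.
by apply: ler_sum => i _.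
Qed.

Lemma nrm_sa_sqr x : self_adjoint x -> nrm (x ** x) = nrm x ^+ 2.
Proof. by move=> sx; rewrite -nrm_star_mul sx. Qed.

Lemma nrm_small_eq0 x : (forall e : R, 0 < e -> nrm x <= e) -> x = 0.
Proof.
move=> h; apply: nrm_eq0; apply/eqP; rewrite eq_le nrm_ge0 andbT.
by apply/ler_addgt0Pr => e e0; rewrite add0r h.
Qed.

Lemma norm_lt_Re (e : R[i]) : 0 < e ->
  0 < complex.Re e /\ forall x, (`|x| < e) = (nrm x < complex.Re e).
Proof.
move=> e0; split=> [|x]; first by move: e0; rewrite ltcE => /andP[].
by rewrite nrmE -{1}(RRe_real (gtr0_real e0)) ltcR.
Qed.

Lemma nrm_cvgP (u : nat -> A) a :
  u n @[n --> \oo] --> a <->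
  forall e : R, 0 < e -> exists N, forall n, (N <= n)%N -> nrm (a - u n) < e.
Proof.
split=> [/cvgrPdist_lt h e e0|h].
  have /h [N _ hN] : 0 < e%:C by rewrite ltcR.
  by exists N => n Nn; rewrite -ltcR -nrmE hN.
apply/cvgrPdist_lt => e /norm_lt_Re[/h[N hN] eE].
by exists N => //= n Nn; rewrite eE hN.
Qed.

Lemma nrm_cauchy_cvg (u : nat -> A) :
  (forall e : R, 0 < e -> exists N, forall m n, (N <= m)%N -> (N <= n)%N ->
    nrm (u m - u n) < e) ->
  exists a, forall e : R, 0 < e ->
    exists N, forall n, (N <= n)%N -> nrm (a - u n) < e.
Proof.
move=> h; have /cauchy_cvgP/cvg_ex[a /nrm_cvgP ua] : cauchy (u n @[n --> \oo]).
  apply: cauchy_exP => e /norm_lt_Re[/h[N hN] eE].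
  exists (u N); exists N => //= n Nn; rewrite -ball_normE /= eE; exact: hN.
by exists a.
Qed.

Lemma closed_nrmP (S : set A) a : closed S ->
  (forall e : R, 0 < e -> exists2 s, S s & nrm (a - s) < e) -> S a.
Proof.
move=> clS h; apply: clS => V /nbhs_ballP[e /= /norm_lt_Re[/h[s Ss sa] eE] eV].
by exists s; split => //; apply: eV; rewrite -ball_normE /= eE.
Qed.

Lemma closed_of_nrm (S : set A) :
  (forall a, (forall e : R, 0 < e -> exists2 s, S s & nrm (a - s) < e) -> S a) ->
  closed S.
Proof.
move=> h a clSa; apply: h => e e0.
have /clSa [s [Ss]] : nbhs a (ball a e%:C) by apply: nbhsx_ballx; rewrite ltcR.
by rewrite -ball_normE /= nrmE ltcR => ?; exists s.
Qed.

Lemma cuntz_leP a b :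
  cuntz_le a b <->
  forall e : R, 0 < e -> exists v, nrm (a - v ** b ** star v) < e.
Proof.
split=> [[v /nrm_cvgP h] e /h[N hN]|h]; first by exists (v N); exact: hN.
have h' n : {v | nrm (a - v ** b ** star v) < n.+1%:R^-1}.
  by apply/cid/h; rewrite invr_gt0.
exists (fun n => sval (h' n)); apply/nrm_cvgP => d /invSn_small[N hN].
exists N => n /hN; exact: lt_trans (svalP (h' n)).
Qed.

Lemma banach_nrm (f : A -> A) (k : R) : 0 <= k -> k < 1 ->
  (forall x y, nrm (f x - f y) <= k * nrm (x - y)) -> exists x, f x = x.
Proof.
move=> k0 k1 fk.
set D := nrm (f 0) / (1 - k); have k10 : 0 < 1 - k by rewrite subr_gt0.
have D0 : 0 <= D by rewrite divr_ge0 ?nrm_ge0 // ltW.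
have fD : nrm (f 0) = D - k * D by rewrite -{1}[D]mul1r -mulrBl mulrC divfK ?gt_eqF.
pose u n := iter n f 0.
have uD n : nrm (u n) <= D.
  elim: n => [|n ih]; first by rewrite nrm0.
  rewrite -[u _](subrK (f 0)) (le_trans (nrmD _ _)) // fD addrCA gerDl subr_le0.
  by rewrite (le_trans (fk _ _)) // subr0 ler_wpM2l.
have uk n j : nrm (u (n + j)%N - u n) <= k ^+ n * D.
  elim: n => [|n ih]; first by rewrite subr0 mul1r uD.
  by rewrite exprS -mulrA (le_trans (fk _ _)) // ler_wpM2l.
have ukD n m e : k ^+ n * D < e -> (n <= m)%N -> nrm (u m - u n) < e.
  by move=> h nm; rewrite -(subnKC nm) (le_lt_trans (uk _ _)).
have kN e : 0 < e -> exists N, k ^+ N * D < e.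
  move=> e0; have D1 : 0 < D + 1 by rewrite ltr_wpDl.
  have [N hN] := expr_small k0 k1 (divr_gt0 e0 D1).
  exists N; rewrite (@le_lt_trans _ _ (k ^+ N * (D + 1))) //.
    by rewrite ler_wpM2l ?exprn_ge0 // lerDl.
  by rewrite -ltr_pdivlMr ?hN.
have [|x xu] := @nrm_cauchy_cvg u.
  move=> e e0; have [N hN] := kN _ (divr_gt0 e0 (ltr0n _ 2)).
  exists N => m n Nm Nn; rewrite (splitr e).
  rewrite (le_lt_trans (nrm_dist_tri (u N) _ _)) // ltrD //.
    exact: ukD Nm.
  by rewrite nrm_distC ukD.
exists x; apply/eqP; rewrite -subr_eq0; apply/eqP/nrm_small_eq0 => e e0.
have [N hN] := xu _ (divr_gt0 e0 (ltr0n _ 2)).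
rewrite (splitr e) (le_trans (nrm_dist_tri (f (u N)) _ _)) // lerD //.
  rewrite (le_trans (fk _ _)) // (le_trans _ (ltW (hN N _))) //.
  by rewrite ler_piMl ?nrm_ge0 ?ltW.
by rewrite nrm_distC ltW // (hN N.+1).
Qed.

End Norm.

(** * The unitization *)
Section Unitization.
Variables (R : realType) (A : cstarAlgType R).

Definition unitz : Type := (A * R[i])%type.

HB.instance Definition _ := GRing.Zmodule.copy unitz (A * R[i])%type.

Implicit Types (u v w : unitz) (l : R[i]).

Definition unitz_mul u v : unitz := unitization_mul u v.
Definition unitz_one : unitz := (0, 1).
Definition unitz_scale l u : unitz := (l *: u.1, l * u.2).

Fact unitz_mulA : associative unitz_mul.
Proof.
move=> [a l] [b m] [c n]; congr (_, _) => /=; last by rewrite mulrA.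
rewrite !cmulDl !cmulDr !cmulZl !cmulZr cmulA.
module_ring.
Qed.

Fact unitz_mul1 : left_id unitz_one unitz_mul.
Proof.
by move=> [a l]; congr (_, _); rewrite /= ?mul1r // cmul0l scale1r scaler0 addr0 add0r.
Qed.

Fact unitz_mulr1 : right_id unitz_one unitz_mul.
Proof.
by move=> [a l]; congr (_, _); rewrite /= ?mulr1 // cmul0r scale1r scaler0 !add0r.
Qed.

Fact unitz_mulDl : left_distributive unitz_mul +%R.
Proof.
move=> [a l] [b m] [c n]; congr (_, _) => /=; last by rewrite mulrDl.
by rewrite cmulDl scalerDl scalerDr [in RHS]addrACA; congr (_ + _); rewrite addrACA.
Qed.

Fact unitz_mulDr : right_distributive unitz_mul +%R.
Proof.
move=> [a l] [b m] [c n]; congr (_, _) => /=; last by rewrite mulrDr.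
by rewrite cmulDr scalerDl scalerDr [in RHS]addrACA; congr (_ + _); rewrite addrACA.
Qed.

Fact unitz_1neq0 : unitz_one != 0.
Proof. by rewrite -[0]/(0, 0) xpair_eqE oner_eq0 andbF. Qed.

HB.instance Definition _ := GRing.Zmodule_isNzRing.Build unitz
  unitz_mulA unitz_mul1 unitz_mulr1 unitz_mulDl unitz_mulDr unitz_1neq0.

Fact unitz_scaleA l m u : unitz_scale l (unitz_scale m u) = unitz_scale (l * m) u.
Proof. by congr (_, _); rewrite /= ?scalerA ?mulrA. Qed.

Fact unitz_scale1 : left_id 1 unitz_scale.
Proof. by move=> [a l]; congr (_, _); rewrite /= ?scale1r ?mul1r. Qed.

Fact unitz_scaleDr : right_distributive unitz_scale +%R.
Proof. by move=> l [a m] [b n]; congr (_, _); rewrite /= ?scalerDr ?mulrDr. Qed.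

Fact unitz_scaleDl u : {morph unitz_scale^~ u : l m / l + m}.
Proof. by move=> l m; congr (_, _); rewrite /= ?scalerDl ?mulrDl. Qed.

HB.instance Definition _ := GRing.Zmodule_isLmodule.Build R[i] unitz
  unitz_scaleA unitz_scale1 unitz_scaleDr unitz_scaleDl.

Fact unitz_scaleAl l u v : l *: (u * v) = (l *: u) * v.
Proof.
congr (_, _); rewrite /= ?mulrA // !scalerDr !scalerA cmulZl.
by rewrite [l * v.2]mulrC.
Qed.

Fact unitz_scaleAr l u v : l *: (u * v) = u * (l *: v).
Proof.
congr (_, _); last by rewrite /= mulrCA.
by rewrite /= !scalerDr !scalerA cmulZr [u.2 * l]mulrC.
Qed.

HB.instance Definition _ := GRing.Lmodule_isLalgebra.Build R[i] unitz unitz_scaleAl.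
HB.instance Definition _ := GRing.Lalgebra_isAlgebra.Build R[i] unitz unitz_scaleAr.

Definition invertible u := exists v, u * v = 1 /\ v * u = 1.

Lemma invertible_lr u v w : u * v = 1 -> w * u = 1 -> invertible u.
Proof.
move=> uv wu; exists v; split => //.
by rewrite -[v]mul1r -wu -(mulrA w) uv mulr1.
Qed.

Lemma invertibleM u v : invertible u -> invertible v -> invertible (u * v).
Proof.
move=> [u' [uu' u'u]] [v' [vv' v'v]]; exists (v' * u').
by rewrite mulrA -(mulrA u) vv' mulr1 uu' mulrA -(mulrA v') u'u mulr1 v'v.
Qed.

Lemma invertible_comm u v : u * v = v * u -> invertible (u * v) -> invertible u.
Proof.
move=> uv [w [uvw wuv]]; apply: (@invertible_lr _ (v * w) (w * v)).
  by rewrite mulrA.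
by rewrite -mulrA -uv.
Qed.

Definition emb (a : A) : unitz := (a, 0).

Lemma spectrumE a l : spectrum a l <-> ~ invertible (emb a - l%:A).
Proof.
rewrite /spectrum /=; suff -> : emb a - l%:A = (a, - l) by [].
by congr (_, _); rewrite /= ?scaler0 ?subr0 // mulr1 sub0r.
Qed.

Lemma emb_inj : injective emb. Proof. by move=> a b []. Qed.

Lemma embM a b : emb (a ** b) = emb a * emb b.
Proof. by congr (_, _); rewrite /= ?scale0r ?addr0 ?mulr0. Qed.

Lemma embD a b : emb (a + b) = emb a + emb b.
Proof. by congr (_, _); rewrite /= addr0. Qed.

Lemma embZ l a : emb (l *: a) = l *: emb a.
Proof. by congr (_, _); rewrite /= mulr0. Qed.

Lemma embN a : emb (- a) = - emb a.
Proof. by congr (_, _); rewrite /= oppr0. Qed.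

End Unitization.

(** * Where the spectrum lies *)
Section Spectrum.
Variables (R : realType) (A : cstarAlgType R).
Implicit Types (a h x y : A) (l m : R[i]).

Definition shift_onto a l := forall y, exists u, a ** u - l *: u = y.

Lemma shift_onto_far a l : nrm a < cabs l -> shift_onto a l.
Proof.
move=> al y; have l0 : 0 < cabs l := le_lt_trans (nrm_ge0 a) al.
have l0' : l != 0 by rewrite -cabs_gt0.
have [|||u fu] := @banach_nrm _ A (fun u => l^-1 *: (a ** u - y)) (nrm a / cabs l).
- by rewrite divr_ge0 ?nrm_ge0 ?cabs_ge0.
- by rewrite ltr_pdivrMr // mul1r.
- move=> u v; rewrite -scalerBr opprB addrA subrK -cmulBr nrmZ cabsV.
  by rewrite [_ / _]mulrC -mulrA ler_wpM2l ?invr_ge0 ?cabs_ge0 // nrmM.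
by exists u; rewrite -{2}fu scalerA mulfV // scale1r subKr.
Qed.

(** Choosing a preimage under [a - l] is Lipschitz with constant [1 / t], so solving for
    [m] is a fixed point equation for a map with constant [|m - l| / t < 1]. *)
Lemma shift_onto_near a l m (t : R) : shift_onto a l ->
  (forall x, t * nrm x <= nrm (a ** x - l *: x)) -> cabs (m - l) < t ->
  shift_onto a m.
Proof.
move=> /(_ _)/cid-sol bd lm y; have t0 : 0 < t := le_lt_trans (cabs_ge0 _) lm.
pose S z := sval (sol z); have SE z : a ** S z - l *: S z = z := svalP (sol z).
have SB z w : nrm (S z - S w) <= nrm (z - w) / t.
  rewrite ler_pdivlMr // mulrC (le_trans (bd _)) // cmulBr scalerBr.
  suff -> : a ** S z - a ** S w - (l *: S z - l *: S w) = z - w by [].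
  by rewrite -[in RHS](SE z) -[in RHS](SE w); module_ring.
have [|||u fu] := @banach_nrm _ A (fun u => S (y + (m - l) *: u)) (cabs (m - l) / t).
- by rewrite divr_ge0 ?cabs_ge0 // ltW.
- by rewrite ltr_pdivrMr // mul1r.
- move=> u v; rewrite (le_trans (SB _ _)) // mulrAC ler_wpM2r ?invr_ge0 ?(ltW t0) //.
  by rewrite opprD addrACA subrr add0r -scalerBr nrmZ.
exists u; have := SE (y + (m - l) *: u); rewrite fu scalerBl addrA => /eqP.
rewrite (inj_eq (addIr _)) => /eqP ->.
by rewrite addrK.
Qed.

(** [h - l] is normal, and a normal operator and its adjoint have the same norm at each
    vector. *)
Lemma nrm_sub_conj h l x : self_adjoint h ->
  nrm (h ** x - l^* *: x) = nrm (h ** x - l *: x).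
Proof.
move=> sh; apply/eqP; rewrite -(eqrXn2 (ltn0Sn 1) (nrm_ge0 _) (nrm_ge0 _)).
rewrite -!nrm_star_mul !starB !starM !starZ sh conjCK !cmulBl !cmulBr.
rewrite !cmulZl !cmulZr !scalerA [l * _]mulrC !cmulA !opprB.
by rewrite addrACA [in eqbRHS]addrACA [- (_ *: _) + - (_ *: _)]addrC.
Qed.

(** The difference of [h - l] and its adjoint is the scalar [2i Im l], while both have
    the same norm at [x]. *)
Lemma sa_lower_bound h l x : self_adjoint h ->
  `|complex.Im l| * nrm x <= nrm (h ** x - l *: x).
Proof.
move=> sh; rewrite -(ler_pM2l (ltr0n R 2)).
have -> : 2 * (`|complex.Im l| * nrm x) = nrm ((l^* - l) *: x).
  rewrite nrmZ mulrA; congr (_ * _).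
  have -> : l^* - l = 0 +i* (- (2 * complex.Im l)).
    by case: l => u v; apply/eqP; rewrite eq_complex /= subrr eqxx -opprD mulr2n mulrDl mul1r /=.
  by rewrite cabs_imag normrN normrM ger0_norm.
have -> : (l^* - l) *: x = (h ** x - l *: x) - (h ** x - l^* *: x).
  by module_ring.
by rewrite (le_trans (nrmB _ _)) // nrm_sub_conj // mulr2n mulrDl mul1r.
Qed.

(** Along the vertical line through [l] the lower bound is proportional to the height, so
    once [h - l] is onto at some height it is onto at half that height. The
    starting point is a height above the norm of [h]. *)
Lemma shift_onto_sa h l : self_adjoint h -> complex.Im l != 0 -> shift_onto h l.
Proof.
move=> sh; case: l => s t /= t0.
(* After [n] doublings the height exceeds the norm of [h]. *)
have [n hn] : exists n, nrm h < `|t| * 2 ^+ n.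
  have h1 : 0 < nrm h + 1 by rewrite ltr_wpDl ?nrm_ge0.
  have e0 : 0 < `|t| / (nrm h + 1) by rewrite divr_gt0 ?normr_gt0.
  have [||n hn] := @expr_small R 2^-1 _ _ _ e0; rewrite ?invr_ge0 ?invf_lt1 ?ltr1n //.
  exists n; have := hn _ (leqnn n); rewrite exprVn ltr_pdivlMr ?ltr_wpDl ?nrm_ge0 //.
  rewrite ltr_pdivrMl ?exprn_gt0 // mulrC; apply: lt_trans.
  by rewrite ltrDl.
elim: n t t0 hn => [|n ih] t t0 hn.
  apply: shift_onto_far; rewrite (lt_le_trans hn) // mulr1.
  exact: (cabs_Im (s +i* t)).
apply: (@shift_onto_near _ (s +i* (2 * t)) _ (`|2 * t|)).
- apply: ih; first by rewrite mulf_neq0 ?pnatr_eq0.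
  by rewrite normrM ger0_norm // [2 * _]mulrC -mulrA -exprS.
- by move=> x; exact: (sa_lower_bound (s +i* (2 * t)) x sh).
- have -> : s +i* t - s +i* (2 * t) = 0 +i* (- t).
    apply/eqP; rewrite eq_complex /= subrr eqxx /=.
    by rewrite mulr2n mulrDl mul1r opprD addrA subrr add0r.
  by rewrite cabs_imag normrN normrM ger0_norm // ltr_pMl ?normr_gt0 ?ltr1n.
Qed.

(** A solution of [a ** u - l *: u = l^-1 *: a] is the part in [A] of an inverse whose scalar
    part is [- l^-1]; the equation for the adjoint gives an inverse on the other side. *)
Lemma shift_onto_invertible a l : l != 0 -> shift_onto a l -> shift_onto (star a) l^* ->
  invertible (emb a - l%:A).
Proof.
move=> l0 /(_ (l^-1 *: a))[u ua] /(_ ((l^-1)^* *: star a))[w wa].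
apply: (@invertible_lr _ _ _ (u, - l^-1) (star w, - l^-1)); congr (_, _) => /=.
- rewrite !scaler0 !subr0 !mulr1 sub0r scaleNr addrC ua.
  by rewrite scaleNr addNr.
- by rewrite sub0r mulr1 mulrNN mulfV.
- move/(congr1 (@star _ _)): wa; rewrite starB starM !starZ starK !conjCK => wa.
  rewrite !scaler0 !subr0 !mulr1 sub0r !scaleNr addrAC wa.
  by rewrite subrr.
- by rewrite sub0r mulr1 mulrNN mulVf.
Qed.

Lemma spectrum_le_nrm a l : spectrum a l -> cabs l <= nrm a.
Proof.
move=> /spectrumE sal; rewrite leNgt; apply/negP => al; apply: sal.
apply: shift_onto_invertible; first by rewrite -cabs_gt0 (le_lt_trans (nrm_ge0 a)).
  exact: shift_onto_far.
by apply: shift_onto_far; rewrite nrm_star cabs_conj.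
Qed.

Lemma spectrum_sa_real h l : self_adjoint h -> spectrum h l ->
  l = (complex.Re l)%:C.
Proof.
move=> sh /spectrumE shl; have [l0|l0] := eqVneq (complex.Im l) 0.
  by apply/eqP; rewrite eq_complex /= l0 !eqxx.
case: shl; apply: shift_onto_invertible; first by apply: contraNneq l0 => ->.
  exact: shift_onto_sa.
by rewrite sh; apply: shift_onto_sa => //; case: l l0 => u v /=; rewrite oppr_eq0.
Qed.

Lemma spectrum0 a : spectrum a 0.
Proof.
apply/spectrumE => -[[b m] [/(congr1 snd) /= /eqP]].
by rewrite mul0r subr0 mul0r eq_sym oner_eq0.
Qed.

End Spectrum.

(** * Polynomials, spectral mapping and spectral radius *)
Section PolyEval.
Variables (R : realType) (A : cstarAlgType R).
Implicit Types (c h x y : A) (l z : R[i]) (P Q : {poly R}) (p : {poly R[i]}).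

Lemma invertible_scalar l : l != 0 -> invertible (l%:A : unitz A).
Proof.
move=> l0; exists l^-1%:A; rewrite -!scalerAl !mul1r !scalerA.
by rewrite mulfV // mulVf // scale1r.
Qed.

(** The polynomial splits into linear factors over the complex numbers. *)
Lemma invertible_horner c p : p != 0 ->
  (forall z, root p z -> ~ spectrum c z) -> invertible (horner_alg (emb c) p).
Proof.
move=> p0 h; have [r pE] := closed_field_poly_normal p.
have {}h z : z \in r -> invertible (emb c - z%:A).
  move=> zr; apply: contrapT => inv; apply: (h z); last exact/spectrumE.
  rewrite pE rootZ ?lead_coef_eq0 // root_prod_XsubC //.
rewrite pE linearZ /= rmorph_prod /=.
apply: invertibleM; first by apply: invertible_scalar; rewrite lead_coef_eq0.
elim: r h {pE} => [|z r ih] h.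
  by rewrite big_nil -[1]scale1r; apply: invertible_scalar; rewrite oner_eq0.
rewrite big_cons; apply: invertibleM.
  by rewrite rmorphB /= horner_algX horner_algC; apply: h; rewrite mem_head.
by apply: ih => y yr; apply: h; rewrite inE yr orbT.
Qed.

Lemma embX c n : emb c ^+ n.+1 = emb (iter n (cmul c) c).
Proof. by elim: n => [|n ih]; rewrite ?expr1 // exprS ih -embM. Qed.

Local Notation toC := (map_poly (real_complex R)).

Lemma emb_poly_eval P c : P`_0 = 0 ->
  emb (poly_eval P c) = horner_alg (emb c) (toC P).
Proof.
move=> P0; rewrite [toC P]poly_def linear_sum /= /poly_eval.
case: (size P) => [|n] /=; first by rewrite !big_ord0.
rewrite big_ord_recl P0 rmorph0 scale0r linear0 add0r.
rewrite (big_morph _ (@embD _ _) (erefl : emb 0 = 0)).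
apply: eq_bigr => i _; rewrite linearZ /= rmorphXn /= horner_algX embX.
by rewrite mulr_algl embZ.
Qed.

Lemma horner_toC P (t : R) : (toC P).[t%:C] = (P.[t])%:C.
Proof. exact: horner_map. Qed.

Lemma spectrum_poly_eval P c l : self_adjoint c -> P`_0 = 0 ->
  spectrum (poly_eval P c) l -> exists2 t : R, spectrum c t%:C & l = (P.[t])%:C.
Proof.
move=> sc P0 /spectrumE; rewrite emb_poly_eval // -(horner_algC (emb c)) -rmorphB /= => nI.
have [z zc pz] : exists2 z, spectrum c z & root (toC P - l%:P) z.
  apply: contrapT => nz; apply: nI; apply: invertible_horner.
    apply: contra_notN nz => /eqP ->; exists 0; [exact: spectrum0|exact: root0].
  by move=> z rz zc; apply: nz; exists z.
exists (complex.Re z); first by rewrite -(spectrum_sa_real sc zc).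
apply/eqP; rewrite eq_sym -subr_eq0 -horner_toC -(spectrum_sa_real sc zc).
by move: pz; rewrite /root hornerD hornerN hornerC.
Qed.

Lemma poly_eval_spectrum P c (t : R) : P`_0 = 0 ->
  spectrum c t%:C -> spectrum (poly_eval P c) (P.[t])%:C.
Proof.
move=> P0 /spectrumE ct; apply/spectrumE; rewrite emb_poly_eval //.
rewrite -(horner_algC (emb c)) -rmorphB /= => inv; apply: ct.
have /factor_theorem[q qE] : root (toC P - (P.[t])%:C%:P) t%:C.
  by rewrite /root hornerD hornerN hornerC horner_toC subrr.
have XE : horner_alg (emb c) ('X - t%:C%:P) = emb c - t%:C%:A.
  by rewrite rmorphB /= horner_algX horner_algC.
rewrite -XE; apply: (@invertible_comm _ _ _ (horner_alg (emb c) q)).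
  by rewrite -!rmorphM mulrC.
by rewrite -rmorphM mulrC -qE.
Qed.

Lemma iter_cmul_self c y n : iter n (cmul c) c ** y = iter n.+1 (cmul c) y.
Proof. by elim: n => //= n ih; rewrite -cmulA ih. Qed.

Lemma iter_cmul_sa c n : self_adjoint c -> self_adjoint (iter n (cmul c) c).
Proof.
move=> sc; elim: n => //= n ih; rewrite /self_adjoint starM ih sc.
by rewrite iter_cmul_self.
Qed.

Lemma poly_eval_sa P c : self_adjoint c -> self_adjoint (poly_eval P c).
Proof.
move=> sc; rewrite /self_adjoint /poly_eval star_sum; apply: eq_bigr => i _.
by rewrite starZ conjc_real_complex iter_cmul_sa.
Qed.

Lemma poly_evalM P Q c : P`_0 = 0 -> Q`_0 = 0 ->
  poly_eval (P * Q) c = poly_eval P c ** poly_eval Q c.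
Proof.
move=> P0 Q0; apply: emb_inj; rewrite embM !emb_poly_eval //.
  by rewrite !rmorphM.
by rewrite coefM big_ord1 P0 mul0r.
Qed.

Lemma poly_evalD P Q c : P`_0 = 0 -> Q`_0 = 0 ->
  poly_eval (P + Q) c = poly_eval P c + poly_eval Q c.
Proof.
move=> P0 Q0; apply: emb_inj; rewrite embD !emb_poly_eval ?coefD ?P0 ?Q0 ?addr0 //.
by rewrite !rmorphD.
Qed.

Lemma poly_evalN P c : P`_0 = 0 -> poly_eval (- P) c = - poly_eval P c.
Proof.
move=> P0; apply: emb_inj; rewrite embN !emb_poly_eval ?coefN ?P0 ?oppr0 //.
by rewrite !rmorphN.
Qed.

Lemma poly_evalX c : poly_eval 'X c = c.
Proof.
by apply: emb_inj; rewrite emb_poly_eval ?coefX // map_polyX horner_algX.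
Qed.

Lemma iter_cmul_star h x y k : self_adjoint h ->
  star (iter k (cmul h) x) ** y = star x ** iter k (cmul h) y.
Proof.
move=> sh; elim: k y => //= k ih y.
by rewrite starM sh -cmulA ih -iterSr.
Qed.

Lemma iter_cmulD h x y k :
  iter k (cmul h) (x + y) = iter k (cmul h) x + iter k (cmul h) y.
Proof. by elim: k => //= k ->; rewrite cmulDr. Qed.

(** With [T] the self-adjoint operator [h^k], the operators [1 - T^2 + 2iT] and
    [1 - T^2 - 2iT] are the squares of [1 + iT] and [1 - iT]; at each vector both have the norm of
    [1 + T^2], and their difference is [4iT]. *)
Lemma nrm_add_sqr_ge h k x : self_adjoint h ->
  2 * nrm (iter k (cmul h) x) <= nrm (x + iter (k + k) (cmul h) x).
Proof.
move=> sh; set x1 := iter k _ x; set x2 := iter _ _ x.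
pose m n := star x ** iter n (cmul h) x.
have m00 : star x ** x = m 0%N by [].
have m01 : star x ** x1 = m k by [].
have m02 : star x ** x2 = m (k + k)%N by [].
have m10 : star x1 ** x = m k by rewrite iter_cmul_star.
have m11 : star x1 ** x1 = m (k + k)%N by rewrite iter_cmul_star // -iterD.
have m12 : star x1 ** x2 = m (k + (k + k))%N by rewrite iter_cmul_star // -iterD.
have m20 : star x2 ** x = m (k + k)%N by rewrite iter_cmul_star.
have m21 : star x2 ** x1 = m (k + (k + k))%N.
  by rewrite iter_cmul_star // -iterD addnC.
have m22 : star x2 ** x2 = m (k + k + (k + k))%N by rewrite iter_cmul_star // -iterD.
(* For [e] equal to 1 or -1, this element is the image of [x] under [1 - T^2 + 2ieT]. *)
have zE (e : R) : e ^+ 2 = 1 ->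
    nrm (x - x2 + (0 +i* (2 * e)) *: x1) = nrm (x + x2).
  move=> e2; apply/eqP; rewrite -(eqrXn2 (ltn0Sn 1) (nrm_ge0 _) (nrm_ge0 _)).
  rewrite -!nrm_star_mul !(starD, starN, starZ) !(cmulDl, cmulDr, cmulNl, cmulNr).
  rewrite !(cmulZl, cmulZr) m00 m01 m02 m10 m11 m12 m20 m21 m22 !scalerA.
  have -> : (0 +i* (2 * e))^* = - (0 +i* (2 * e)) :> R[i].
    by apply/eqP; rewrite eq_complex /= oppr0 !eqxx.
  have -> : - (0 +i* (2 * e)) * (0 +i* (2 * e)) = 4 :> R[i].
    have -> : (4 : R[i]) = (4 : R)%:C by rewrite rmorph_nat.
    apply/eqP; rewrite eq_complex /= !(mul0r, mulr0, oppr0, addr0, subr0, sub0r) eqxx andbT.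
    by rewrite mulNr opprK mulrACA -[e * e]expr2 e2; apply/eqP; ring.
  apply/eqP; congr nrm; module_ring.
have -> : x1 = - (0 +i* 4^-1) *: ((x - x2 + (0 +i* (2 * 1)) *: x1)
                - (x - x2 + (0 +i* (2 * -1)) *: x1)).
  have -> : forall u v w : A, (u + v) - (u + w) = v - w by move=> u v w; module_ring.
  rewrite -scalerBl scalerA -[LHS]scale1r; congr (_ *: _).
  by apply/eqP; rewrite eq_complex /=; apply/andP; split; apply/eqP; field.
rewrite nrmZ cabsN cabs_imag.
rewrite ger0_norm ?invr_ge0 // mulrA.
rewrite (@le_trans _ _ (2 * 4^-1 * (nrm (x + x2) + nrm (x + x2)))) //.
  rewrite ler_wpM2l ?mulr_ge0 ?invr_ge0 // (le_trans (nrmB _ _)) //.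
  by rewrite !zE ?sqrrN ?expr1n.
by rewrite le_eqVlt; apply/orP; left; apply/eqP; field.
Qed.

(** The product of the [1 + h^(2^(j+1))] for [j < m] is the sum of the [h^(2k)] for
    [k < 2^m]; multiplied by [1 - h^2] it telescopes to [1 - h^(2^(m+1))], of norm at most 2. But
    each factor at least doubles the norm in the sense of [nrm_add_sqr_ge], so at [h] the
    product has norm at least [2^m]. No lower bound for [1 - h^2] survives this. *)
Lemma not_bounded_below h (K : R) : self_adjoint h -> nrm h = 1 ->
  ~ forall x, nrm x <= K * nrm (x - h ** (h ** x)).
Proof.
move=> sh h1 hK; pose T n := iter n (cmul h).
have Tn n x : nrm (T n x) <= nrm x.
  elim: n => //= n ih; rewrite (le_trans (nrmM _ _)) // h1 mul1r //.
(* [X m] multiplies by the product of the [1 + h^(2^(j+1))] with [j < m]. *)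
pose X := fix X m x := if m is m'.+1 then X m' (x + T (2 ^ m)%N x) else x.
have XT m x : X m x - h ** (h ** X m x) = x - T (2 ^ m.+1)%N x.
  elim: m x => [|m ih] x //; rewrite ih /T iter_cmulD -iterD addnn -mul2n -expnS.
  by rewrite opprD addrA addrK.
have XB m x : 2 ^+ m * nrm (T (2 ^ m).-1 x) <= nrm (X m x).
  elim: m x => [|m ih] x; first by rewrite mul1r.
  rewrite (le_trans _ (ih _)) // exprSr -mulrA ler_wpM2l ?exprn_ge0 //.
  rewrite /T iter_cmulD -iterD addnC iterD.
  have -> : (2 ^ m.+1).-1 = (2 ^ m + (2 ^ m).-1)%N.
    by rewrite expnS mul2n -addnn -subn1 -addnBA ?expn_gt0 // subn1.
  by rewrite iterD expnS mul2n -addnn nrm_add_sqr_ge.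
have hn m : nrm (T (2 ^ m).-1 h) = 1.
  elim: m => // m ih; have -> : (2 ^ m.+1).-1 = ((2 ^ m).-1.+1 + (2 ^ m).-1)%N.
    by rewrite prednK ?expn_gt0 // expnS mul2n -addnn -subn1 -addnBA ?expn_gt0 // subn1.
  rewrite /T iterD -iter_cmul_self nrm_sa_sqr; last exact: iter_cmul_sa.
  by rewrite ih expr1n.
have mK m : 2 ^+ m <= K * nrm (h - T (2 ^ m.+1)%N h).
  by have := XB m h; rewrite hn mulr1 => /le_trans; apply; rewrite -XT; exact: hK.
have K0 : 0 < K.
  have := lt_le_trans ltr01 (mK 0%N); rewrite ltNge; apply: contraTT.
  by rewrite -leNgt => K0; rewrite negbK mulr_le0_ge0 ?nrm_ge0.
have [|||N hN] := @expr_small R 2^-1 (K * 2)^-1.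
- by rewrite invr_ge0.
- by rewrite invf_lt1 ?ltr1n.
- by rewrite invr_gt0 mulr_gt0.
have := hN N (leqnn N); rewrite exprVn ltf_pV2 ?posrE ?exprn_gt0 ?mulr_gt0 //.
apply/negP; rewrite -leNgt (le_trans (mK N)) // ler_pM2l // (le_trans (nrmB _ _)) //.
by rewrite -[2]/(1 + 1) lerD // -?h1 // Tn.
Qed.

(** Otherwise [h] minus its norm and [h] plus its norm are both invertible, and an inverse
    of their product bounds [1 - g^2] from below for the normalized [g]. *)
Lemma spectral_radius_sa h : self_adjoint h ->
  exists2 t : R, spectrum h t%:C & `|t| = nrm h.
Proof.
move=> sh; have [h0|h0] := eqVneq (nrm h) 0.
  by exists 0; [exact: spectrum0|rewrite normr0 h0].
have hp : 0 < nrm h by rewrite lt_neqAle eq_sym h0 nrm_ge0.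
apply: contrapT => nospec.
have inv (e : R) : `|e| = 1 -> invertible (emb h - (e * nrm h)%:C%:A).
  move=> e1; apply: contrapT => ninv; apply: nospec; exists (e * nrm h).
    exact/spectrumE.
  by rewrite normrM e1 mul1r (ger0_norm (nrm_ge0 h)).
have := inv 1; have := inv (-1).
rewrite normrN1 normr1 mulN1r mul1r => /(_ erefl) inv1 /(_ erefl) inv2.
have [v [_]] := invertibleM inv1 inv2.
set u := (_ - _) * (_ - _) => vu.
pose M := nrm h; pose g := (M^-1)%:C *: h.
have sg : self_adjoint g by rewrite /self_adjoint starZ conjc_real_complex sh.
have g1 : nrm g = 1 by rewrite nrmZR ger0_norm ?invr_ge0 ?nrm_ge0 // mulVf.
have uE x : u * emb x = emb (h ** (h ** x) - (M ^+ 2)%:C *: x).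
  have step (t : R) y : (emb h - t%:C%:A) * emb y = emb (h ** y - t%:C *: y).
    by rewrite mulrBl -scalerAl mul1r -embM -embZ -embN -embD.
  rewrite /u -mulrA !step; congr emb; rewrite !cmulBr !cmulZr rmorphN rmorphXn /= -/M.
  module_ring.
have vE x : v * emb x = emb (v.1 ** x + v.2 *: x).
  by congr (_, _); rewrite /= ?mulr0 // scale0r addr0.
apply: (@not_bounded_below g ((nrm v.1 + cabs v.2) * M ^+ 2) sg g1) => x.
have xE : x = v.1 ** (h ** (h ** x) - (M ^+ 2)%:C *: x) +
               v.2 *: (h ** (h ** x) - (M ^+ 2)%:C *: x).
  by apply: emb_inj; rewrite -vE -uE mulrA vu mul1r.
rewrite {1}xE (le_trans (nrmD _ _)) // nrmZ -mulrA mulrDl.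
have -> : M ^+ 2 * nrm (x - g ** (g ** x)) = nrm (h ** (h ** x) - (M ^+ 2)%:C *: x).
  rewrite -[M ^+ 2 in LHS]ger0_norm ?sqr_ge0 // -nrmZR -nrmN; congr nrm.
  rewrite /g !cmulZl cmulZr scalerBr !scalerA -!rmorphM /=.
  have -> : M ^+ 2 * (M^-1 * M^-1) = 1 by rewrite -expr2 -exprMn mulfV // expr1n.
  by rewrite opprB scale1r.
by rewrite lerD2r nrmM.
Qed.

(** The spectral radius formula at [P(c)] and the spectral mapping theorem turn the norm into
    a supremum over the spectrum. *)
Lemma nrm_poly_eval_le P c (m : R) : self_adjoint c -> P`_0 = 0 ->
  (forall t : R, spectrum c t%:C -> `|P.[t]| <= m) -> nrm (poly_eval P c) <= m.
Proof.
move=> sc P0 Pm; have [t /spectrum_poly_eval ct <-] := spectral_radius_sa (poly_eval_sa P sc).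
by have [//|//|s cs /complexI ->] := ct; exact: Pm.
Qed.

Lemma nrm_poly_eval_ge P c (t : R) : P`_0 = 0 -> spectrum c t%:C ->
  `|P.[t]| <= nrm (poly_eval P c).
Proof.
by move=> P0 ct; rewrite -cabsR; apply/spectrum_le_nrm/poly_eval_spectrum.
Qed.

End PolyEval.

(** * Polynomial approximation *)
Section Weierstrass.
Variable R : realType.
Implicit Types (f g : R -> R) (t x : R) (n : nat).

(** Uniform continuity with a quadratic error term: this is the form that the variance
    of the binomial distribution consumes in Bernstein's argument, and it follows from uniform
    continuity for bounded functions. *)
Definition quad_modulus f := forall e : R, 0 < e ->
  exists K : R, 0 <= K /\ forall x t, `|f x - f t| <= e + K * (x - t) ^+ 2.

Lemma lipschitz_quad_modulus f (L : R) :
  (forall x t, `|f x - f t| <= L * `|x - t|) -> quad_modulus f.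
Proof.
move=> fL e e0; exists (L ^+ 2 / (4 * e)); split.
  by rewrite divr_ge0 ?sqr_ge0 // mulr_ge0 // ltW.
move=> x t; rewrite (le_trans (fL x t)) // -(real_normK (num_real (x - t))).
have e40 : 0 < 4 * e by rewrite mulr_gt0.
set d := `|_|; rewrite -subr_ge0.
have -> : e + L ^+ 2 / (4 * e) * d ^+ 2 - L * d = (L * d - 2 * e) ^+ 2 / (4 * e).
  by field; rewrite gt_eqF.
by rewrite divr_ge0 ?sqr_ge0 // ltW.
Qed.

Lemma sqrt_quad_modulus f : (forall t, 0 <= f t) -> quad_modulus f ->
  quad_modulus (fun t => Num.sqrt (f t)).
Proof.
move=> f0 fm e e0; have e20 : 0 < e / 2 by rewrite divr_gt0.
have [K [K0 fK]] := fm _ (exprn_gt0 2 e20).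
exists (K / e); split; first by rewrite divr_ge0 // ltW.
move=> x t; have := fK x t; rewrite -{1}(sqr_sqrtr (f0 x)) -{1}(sqr_sqrtr (f0 t)).
have := sqrtr_ge0 (f x); have := sqrtr_ge0 (f t).
set a := Num.sqrt (f x); set b := Num.sqrt (f t); set d := _ ^+ 2 => b0 a0 h.
have ab : `|a - b| ^+ 2 <= `|a ^+ 2 - b ^+ 2|.
  rewrite subr_sqr normrM expr2 ler_wpM2l // ler_norml.
  by rewrite (ger0_norm (addr_ge0 a0 b0)); lra.
have {h}h := le_trans ab h.
rewrite -(ler_pM2r e0) mulrDl mulrAC divfK ?gt_eqF //.
have := sqr_ge0 (`|a - b| - e / 2); move: h; nra.
Qed.

(** The expectation of [g] at the number of successes in [n] independent trials of
    probability ['X], by recursion on the first trial. *)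
Fixpoint bernstein n (g : nat -> R) : {poly R} :=
  if n is n'.+1 then (1 - 'X) * bernstein n' g + 'X * bernstein n' (g \o S)
  else (g 0)%:P.

Lemma horner_bernsteinS n (g : nat -> R) x : (bernstein n.+1 g).[x] =
  (1 - x) * (bernstein n g).[x] + x * (bernstein n (g \o S)).[x].
Proof. by rewrite /= !hornerE. Qed.

Lemma bernstein_le n (g h : nat -> R) x : 0 <= x <= 1 ->
  (forall k, g k <= h k) -> (bernstein n g).[x] <= (bernstein n h).[x].
Proof.
move=> /andP[x0 x1]; elim: n g h => [|n ih] g h gh; first by rewrite !hornerC.
rewrite !horner_bernsteinS.
by rewrite lerD // ler_wpM2l ?subr_ge0 // ih // => k; exact: gh.
Qed.

(** The mean is [n x] and the variance [n x (1 - x)]. *)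
Lemma bernstein_quad n (a b c x : R) :
  (bernstein n (fun k => a + b * k%:R + c * k%:R ^+ 2)).[x] =
  a + b * (n%:R * x) + c * (n%:R * (x * (1 - x)) + (n%:R * x) ^+ 2).
Proof.
elim: n a b c => [|n ih] a b c; first by rewrite hornerC; ring.
rewrite horner_bernsteinS ih.
have -> : (fun k => a + b * k%:R + c * k%:R ^+ 2) \o S =
   fun k => (a + b + c) + (b + 2 * c) * k%:R + c * k%:R ^+ 2 :> R.
  by apply/funext => k /=; rewrite -natr1; ring.
by rewrite ih -natr1; ring.
Qed.

(** The modulus bounds [f] above and below by quadratic functions centred at [x]; the
    Bernstein operator is monotone and evaluates them exactly. *)
Lemma bernstein_approx f (e K x : R) n : (0 < n)%N -> 0 <= x <= 1 -> 0 <= K ->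
  (forall x t, `|f x - f t| <= e + K * (x - t) ^+ 2) ->
  `|(bernstein n (fun k => f (k%:R / n%:R))).[x] - f x| <= e + K / n%:R.
Proof.
move=> n0 x01 K0 fK; have n0' : n%:R != 0 :> R by rewrite pnatr_eq0 -lt0n.
have x1 : x * (1 - x) <= 1 by move: x01; nra.
(* The upper bound is the case [s = 1], the lower bound the case [s = -1]. *)
have bd (s : R) : `|s| = 1 ->
    (bernstein n (fun k => (f x + s * e) + s * K * (k%:R / n%:R - x) ^+ 2)).[x] =
    f x + s * (e + K / n%:R * (x * (1 - x))).
  move=> _; have -> : (fun k : nat => (f x + s * e) + s * K * (k%:R / n%:R - x) ^+ 2) =
     fun k => (f x + s * e + s * K * x ^+ 2) + (- 2 * x * s * K / n%:R) * k%:R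
              + (s * K / n%:R ^+ 2) * k%:R ^+ 2.
    by apply/funext => k; field.
  by rewrite bernstein_quad; field.
have Kn : K / n%:R * (x * (1 - x)) <= K / n%:R.
  by rewrite ler_piMr // divr_ge0.
rewrite ler_distl; apply/andP; split.
  apply: (@le_trans _ _ (f x + -1 * (e + K / n%:R * (x * (1 - x))))); first by lra.
  rewrite -bd ?normrN1 //; apply: bernstein_le => // k.
  by have := fK (k%:R / n%:R) x; rewrite ler_norml => /andP[]; lra.
apply: (@le_trans _ _ (f x + 1 * (e + K / n%:R * (x * (1 - x))))); last by lra.
rewrite -bd ?normr1 //; apply: bernstein_le => // k.
by have := fK (k%:R / n%:R) x; rewrite ler_norml => /andP[]; lra.
Qed.

(** Bernstein's theorem, transported from the unit interval. Subtracting the value at 0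
    removes the constant term at the cost of doubling the error. *)
Theorem weierstrass f (M e : R) : quad_modulus f -> f 0 = 0 -> 0 < e ->
  exists P : {poly R}, P`_0 = 0 /\ forall t, `|t| <= M -> `|P.[t] - f t| <= e.
Proof.
move=> fm f0 e0; wlog M0 : M / 0 < M => [wl|].
  have [|P [P0 PM]] := wl (`|M| + 1); first by rewrite ltr_wpDl.
  by exists P; split => // t tM; apply: PM; move: tM; have := ler_norm M; lra.
(* [u] maps the unit interval onto the interval from [- M] to [M]. *)
pose u x := 2 * M * x - M; pose g x := f (u x).
have e40 : 0 < e / 4 by rewrite divr_gt0.
have [K [K0 fK]] := fm _ e40.
pose K' := K * (2 * M) ^+ 2; have K'0 : 0 <= K' by rewrite mulr_ge0 ?sqr_ge0.
have gK x t : `|g x - g t| <= e / 4 + K' * (x - t) ^+ 2.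
  rewrite (le_trans (fK _ _)) // (_ : u x - u t = 2 * M * (x - t)) /u; last by ring.
  by rewrite exprMn mulrA.
pose n := (Num.truncn (K' / (e / 4))).+1.
have Kn : K' / n%:R <= e / 4.
  rewrite ler_pdivrMr ?ltr0n // -ler_pdivrMl // mulrC.
  by rewrite ltW // truncnS_gt.
pose B := bernstein n (fun k => g (k%:R / n%:R)).
pose Q := B \Po ((2 * M)^-1 *: ('X + M%:P)).
have M2 : 2 * M != 0 by rewrite mulf_neq0 ?gt_eqF.
have QM t : `|t| <= M -> `|Q.[t] - f t| <= e / 2.
  rewrite ler_norml => /andP[tM1 tM2]; set x := (2 * M)^-1 * (t + M).
  have x01 : 0 <= x <= 1.
    have tM0 : 0 <= t + M by lra.
    apply/andP; split; first by rewrite /x mulr_ge0 // invr_ge0 mulr_ge0 // ltW.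
    by rewrite ler_pdivrMl ?mulr_gt0 // mulr1; lra.
  have -> : Q.[t] = B.[x] by rewrite horner_comp !hornerE.
  have -> : f t = g x by rewrite /g /u /x mulrA mulfV // mul1r addrK.
  rewrite (le_trans (bernstein_approx _ x01 K'0 gK)) //; lra.
exists (Q - (Q.[0])%:P); split.
  by rewrite coefB coefC -horner_coef0 subrr.
move=> t tM; have := QM t tM; have := QM 0; rewrite normr0 f0 subr0 hornerD hornerN hornerC.
move=> /(_ (ltW M0)) h1 h2; rewrite -addrA [- _ + _]addrC addrA.
by rewrite (le_trans (ler_normB _ _)) //; lra.
Qed.

End Weierstrass.

(** * Continuous functional calculus *)
Section FunctionalCalculus.
Variables (R : realType) (A : cstarAlgType R).
Implicit Types (c d x y : A) (f g : R -> R) (P Q : {poly R}) (t : R).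

Lemma is_funcalcP f c d : is_funcalc f c d <->
  forall e : R, 0 < e -> exists P, [/\ P`_0 = 0,
    forall t, spectrum c t%:C -> `|P.[t] - f t| <= e & nrm (d - poly_eval P c) <= e].
Proof.
by split=> h e /h[P [P0 Pf Pd]]; exists P; split; rewrite // ?nrmE ?lecR // -lecR -nrmE.
Qed.

Lemma spectrum_bound c t : spectrum c t%:C -> `|t| <= nrm c.
Proof. by move/spectrum_le_nrm; rewrite cabsR. Qed.

Lemma poly_eval_dist P Q c (m : R) : self_adjoint c -> P`_0 = 0 -> Q`_0 = 0 ->
  (forall t, spectrum c t%:C -> `|P.[t] - Q.[t]| <= m) ->
  nrm (poly_eval P c - poly_eval Q c) <= m.
Proof.
move=> sc P0 Q0 PQ; rewrite -poly_evalN // -poly_evalD ?coefN ?Q0 ?oppr0 //.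
apply: nrm_poly_eval_le => // [|t ct]; first by rewrite coefD coefN P0 Q0 subr0.
by rewrite hornerD hornerN PQ.
Qed.

(** Polynomials converging to [f] on the spectrum have values at [c] forming a Cauchy sequence. *)
Lemma funcalc_exists f c : self_adjoint c -> quad_modulus f -> f 0 = 0 ->
  exists d, is_funcalc f c d.
Proof.
move=> sc fm f0; pose e n : R := n.+1%:R^-1.
have e0 n : 0 < e n by rewrite invr_gt0.
have /(_ _)/cid-PE n := weierstrass (nrm c) fm f0 (e0 n).
pose P n := sval (PE n).
have P0 n : (P n)`_0 = 0 := (svalP (PE n)).1.
have Pf n t : spectrum c t%:C -> `|(P n).[t] - f t| <= e n.
  by move/spectrum_bound; exact: (svalP (PE n)).2.
have Pd Q n (a : R) : Q`_0 = 0 -> (forall t, spectrum c t%:C -> `|Q.[t] - f t| <= a) ->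
    nrm (poly_eval Q c - poly_eval (P n) c) <= a + e n.
  move=> Q0 Qf; apply: poly_eval_dist => // t ct.
  have -> : Q.[t] - (P n).[t] = (Q.[t] - f t) - ((P n).[t] - f t) by ring.
  rewrite (le_trans (ler_normB _ _)) // lerD //.
    exact: Qf.
  exact: Pf.
have [|d dP] := @nrm_cauchy_cvg _ A (fun n => poly_eval (P n) c).
  move=> a a0; have [N hN] := invSn_small (divr_gt0 a0 (ltr0n _ 2)).
  exists N => m n Nm Nn; rewrite (le_lt_trans (Pd _ n _ (P0 m) (Pf m))) //.
  by rewrite (splitr a) ltrD // hN.
exists d; apply/is_funcalcP => a a0.
have [N1 h1] := dP _ a0; have [N2 h2] := invSn_small a0.
exists (P (maxn N1 N2)); split => // [t ct|].
  by rewrite (le_trans (Pf _ _ ct)) // ltW // h2 // leq_maxr.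
by rewrite ltW // h1 // leq_maxl.
Qed.

Section SelfAdjoint.
Variable c : A.
Hypothesis sc : self_adjoint c.

(** The calculus is isometric for the supremum over the spectrum; in particular its
    values are unique. *)
Lemma funcalc_dist f g d x (m : R) : is_funcalc f c d -> is_funcalc g c x ->
  (forall t, spectrum c t%:C -> `|f t - g t| <= m) -> nrm (d - x) <= m.
Proof.
move=> /is_funcalcP fd /is_funcalcP gx fg; apply/ler_addgt0Pr => e e0.
have e40 : 0 < e / 4 by rewrite divr_gt0.
have [P [P0 Pf Pd]] := fd _ e40; have [Q [Q0 Qg Qx]] := gx _ e40.
have PQ : nrm (poly_eval P c - poly_eval Q c) <= m + e / 4 + e / 4.
  apply: poly_eval_dist => // t ct.
  have -> : P.[t] - Q.[t] = (P.[t] - f t) + (f t - g t) - (Q.[t] - g t) by ring.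
  rewrite (le_trans (ler_normB _ _)) // lerD ?Qg // (le_trans (ler_normD _ _)) //.
  by rewrite addrC lerD ?fg ?Pf.
have := nrm_dist_tri (poly_eval P c) d x.
have := nrm_dist_tri (poly_eval Q c) (poly_eval P c) x.
rewrite (nrm_distC (poly_eval Q c)); lra.
Qed.

Lemma funcalc_unique f d x : is_funcalc f c d -> is_funcalc f c x -> d = x.
Proof.
move=> fd fx; apply/eqP; rewrite -subr_eq0; apply/eqP/nrm_eq0/eqP.
rewrite eq_le nrm_ge0 andbT; apply: (funcalc_dist fd fx) => t _.
by rewrite subrr normr0.
Qed.

Lemma is_funcalc_eq f g d : is_funcalc f c d ->
  (forall t, spectrum c t%:C -> f t = g t) -> is_funcalc g c d.
Proof.
move=> /is_funcalcP h fg; apply/is_funcalcP => e /h[P [P0 Pf Pd]].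
by exists P; split => // t ct; rewrite -fg // Pf.
Qed.

Lemma funcalcE f d : is_funcalc f c d -> funcalc f c = d.
Proof.
by move=> fd; apply: (@funcalc_unique f) => //; rewrite /funcalc; case: xgetP => // /(_ d).
Qed.

Lemma is_funcalc_id : is_funcalc id c c.
Proof.
apply/is_funcalcP => e e0; exists 'X; split => [|t _|]; first by rewrite coefX.
  by rewrite hornerX subrr normr0 ltW.
by rewrite poly_evalX subrr nrm0 ltW.
Qed.

Lemma funcalc_nrm_ge f d t : is_funcalc f c d -> spectrum c t%:C ->
  `|f t| <= nrm d.
Proof.
move=> /is_funcalcP h ct; apply/ler_addgt0Pr => e e0.
have [P [P0 Pf Pd]] := h _ (divr_gt0 e0 (ltr0n _ 2)).
have := nrm_poly_eval_ge P0 ct; have := Pf _ ct; have := nrm_sub_ge (poly_eval P c) d.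
rewrite nrm_distC; have := ler_normB P.[t] (P.[t] - f t); rewrite subKr; lra.
Qed.

Lemma is_funcalcM f g d x : is_funcalc f c d -> is_funcalc g c x ->
  is_funcalc (fun t => f t * g t) c (d ** x).
Proof.
move=> fd gx; apply/is_funcalcP => e e0.
have fb t (ct : spectrum c t%:C) := funcalc_nrm_ge fd ct.
have gb t (ct : spectrum c t%:C) := funcalc_nrm_ge gx ct.
set F := nrm d in fb *; set G := nrm x in gb *.
have F0 : 0 <= F := nrm_ge0 d; have G0 : 0 <= G := nrm_ge0 x.
pose a := Num.min 1 (e / (F + G + 1)).
have FG : 0 < F + G + 1 by lra.
have a0 : 0 < a by rewrite lt_min ltr01 divr_gt0.
have a1 : a <= 1 by rewrite ge_min lexx.
have ae : a * (F + G + 1) <= e by rewrite -ler_pdivlMr // ge_min lexx orbT.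
move/is_funcalcP/(_ _ a0): fd => [P [P0 Pf Pd]].
move/is_funcalcP/(_ _ a0): gx => [Q [Q0 Qg Qx]].
exists (P * Q); split => [|t ct|]; first by rewrite coefM big_ord1 P0 mul0r.
  have -> : (P * Q).[t] - f t * g t =
      P.[t] * (Q.[t] - g t) + (P.[t] - f t) * g t by rewrite hornerM; ring.
  rewrite (le_trans (ler_normD _ _)) // !normrM (le_trans _ ae) //.
  have p1 : `|P.[t]| <= F + 1.
    rewrite -[P.[t]](subrK (f t)) (le_trans (ler_normD _ _)) // addrC.
    by rewrite lerD ?fb // (le_trans (Pf _ ct)).
  have -> : a * (F + G + 1) = (F + 1) * a + a * G by ring.
  by rewrite lerD // ler_pM // ?Qg ?Pf ?gb.
have -> : d ** x - poly_eval (P * Q) c =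
    d ** (x - poly_eval Q c) + (d - poly_eval P c) ** poly_eval Q c.
  by rewrite poly_evalM // cmulBr cmulBl addrA subrK.
rewrite (le_trans (nrmD _ _)) // (le_trans (lerD (nrmM _ _) (nrmM _ _))) //.
rewrite (le_trans _ ae) //.
have q1 : nrm (poly_eval Q c) <= G + 1.
  have := nrm_sub_ge (poly_eval Q c) x; rewrite nrm_distC -/G; lra.
have -> : a * (F + G + 1) = F * a + a * (G + 1) by ring.
by rewrite lerD // ler_pM ?nrm_ge0.
Qed.

Lemma is_funcalcB f g d x : is_funcalc f c d -> is_funcalc g c x ->
  is_funcalc (fun t => f t - g t) c (d - x).
Proof.
move=> /is_funcalcP fd /is_funcalcP gx; apply/is_funcalcP => e e0.
have e20 : 0 < e / 2 by rewrite divr_gt0.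
have [P [P0 Pf Pd]] := fd _ e20; have [Q [Q0 Qg Qx]] := gx _ e20.
have Q0' : (- Q)`_0 = 0 by rewrite coefN Q0 oppr0.
exists (P - Q); split => [|t ct|]; first by rewrite coefB P0 Q0 subr0.
  rewrite hornerD hornerN (splitr e).
  have -> : P.[t] - Q.[t] - (f t - g t) = (P.[t] - f t) - (Q.[t] - g t) by ring.
  by rewrite (le_trans (ler_normB _ _)) // lerD ?Pf ?Qg.
rewrite poly_evalD // poly_evalN // (splitr e).
have -> : d - x - (poly_eval P c - poly_eval Q c) =
    (d - poly_eval P c) - (x - poly_eval Q c) by module_ring.
by rewrite (le_trans (nrmB _ _)) // lerD.
Qed.

Lemma funcalc_closed (S : set A) f d : is_funcalc f c d -> closed S ->
  (forall P, P`_0 = 0 -> S (poly_eval P c)) -> S d.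
Proof.
move=> /is_funcalcP h clS SP; apply: closed_nrmP => // e e0.
have [P [P0 _ Pd]] := h _ (divr_gt0 e0 (ltr0n _ 2)).
exists (poly_eval P c); first exact: SP.
by rewrite (le_lt_trans Pd) // ltr_pdivrMr // ltr_pMr // ltr1n.
Qed.

Lemma funcalc_sa f d : is_funcalc f c d -> self_adjoint d.
Proof.
move=> fd; apply: (funcalc_closed fd) => [|P P0]; last exact: poly_eval_sa.
apply: closed_of_nrm => a h; apply/eqP; rewrite -subr_eq0; apply/eqP/nrm_small_eq0.
move=> e e0; have [s ss] := h _ (divr_gt0 e0 (ltr0n _ 2)).
have := nrm_dist_tri s (star a) a; rewrite -{1}ss -starB nrm_star (nrm_distC s).
lra.
Qed.

End SelfAdjoint.

End FunctionalCalculus.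

(** * Star-homomorphisms, projections and Cuntz subequivalence *)
Section RealFunctions.
Variable R : realType.
Implicit Types (e x t n : R).

(** The characteristic function of a neighbourhood of 1, made continuous across the gap
    that the spectrum of an almost idempotent element leaves between 0 and 1. *)
Definition clamp t : R := Num.max 0 (Num.min 1 (3 * t - 1)).

Lemma clampE t : clamp t = if t <= 3^-1 then 0 else if 2 / 3 <= t then 1 else 3 * t - 1.
Proof.
rewrite /clamp maxEle minEle; case: (leP t) => h1; case: (leP (2 / 3) t) => h2.
all: case: (leP 1 (3 * t - 1)) => h3; case: leP => h4; lra.
Qed.

Lemma clamp_lipschitz x t : `|clamp x - clamp t| <= 3 * `|x - t|.
Proof.
have := ler_norm (x - t); have := ler_norm (t - x); rewrite distrC => h1 h2.
rewrite !clampE ler_norml.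
case: (leP x) => ?; case: (leP t) => ?; case: (leP (2/3) x) => ?; case: (leP (2/3) t) => ?;
 apply/andP; split; lra.
Qed.

Lemma clamp_almost_idem t n : `|t * t - t| <= n -> n < 2 / 9 ->
  (t <= 3^-1 \/ 2 / 3 <= t) /\ `|clamp t - t| <= 2 * n.
Proof.
move=> tn n1; have n0 : 0 <= n := le_trans (normr_ge0 _) tn.
have : t <= 3^-1 \/ 2 / 3 <= t.
  move: tn; rewrite ler_norml => /andP[]; case: (leP t 3^-1); case: (leP (2/3) t); auto.
  nra.
move=> h; split=> //; rewrite clampE; move: tn; rewrite !ler_norml => /andP[h1 h2].
case: h => h; first by rewrite h; case: (leP 0 t) => t0; apply/andP; split; nra.
rewrite h ifF; last by apply/negbTE; rewrite -ltNge; lra.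
by case: (leP t 1) => t1; apply/andP; split; nra.
Qed.

(** Its square times the identity is [max (t - e) 0], so it conjugates [c] to
    [(c - e)_+]. *)
Definition cutdown_root e t : R := Num.sqrt (1 - e / Num.max t e).

Lemma max_lipschitz e x t : `|Num.max x e - Num.max t e| <= `|x - t|.
Proof.
have := ler_norm (x - t); have := ler_norm (t - x); rewrite distrC => h1 h2.
by rewrite ler_norml; case: (leP x) => ?; case: (leP t) => ?; apply/andP; split; lra.
Qed.

Lemma inv_max_lipschitz e x t : 0 < e ->
  `|(Num.max x e)^-1 - (Num.max t e)^-1| <= (e ^+ 2)^-1 * `|x - t|.
Proof.
move=> e0; have mx : e <= Num.max x e by rewrite le_max lexx orbT.
have mt : e <= Num.max t e by rewrite le_max lexx orbT.
have mx0 := lt_le_trans e0 mx; have mt0 := lt_le_trans e0 mt.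
have -> : (Num.max x e)^-1 - (Num.max t e)^-1 =
    (Num.max t e - Num.max x e) / (Num.max x e * Num.max t e).
  by field; rewrite !gt_eqF.
rewrite normrM mulrC distrC ler_pM ?max_lipschitz //.
rewrite normfV (ger0_norm (mulr_ge0 (ltW mx0) (ltW mt0))) lef_pV2 ?posrE ?mulr_gt0 ?exprn_gt0 //.
by rewrite expr2 ler_pM // (ltW e0).
Qed.

(** Its square times the identity is [clamp], so it conjugates an almost idempotent
    element to the projection near it. *)
Definition inv_root t : R := Num.sqrt (clamp t / Num.max t 3^-1).

Lemma cutdown_root_quad_modulus e : 0 < e -> quad_modulus (cutdown_root e).
Proof.
move=> e0.
apply: sqrt_quad_modulus => [t|].
  rewrite subr_ge0 ler_pdivrMr ?lt_max ?e0 ?orbT // mul1r.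
  by rewrite le_max lexx orbT.
apply: (@lipschitz_quad_modulus _ _ (e * (e ^+ 2)^-1)) => x t.
rewrite opprB addrC addrA subrK -mulrBr normrM (ger0_norm (ltW e0)) -mulrA.
by rewrite ler_pM2l // distrC inv_max_lipschitz.
Qed.

Lemma clamp_ge0 t : 0 <= clamp t.
Proof. by rewrite /clamp le_max lexx. Qed.

Lemma clamp_le1 t : clamp t <= 1.
Proof. by rewrite /clamp ge_max ler01 ge_min lexx. Qed.

Lemma inv_root_quad_modulus : quad_modulus inv_root.
Proof.
have m0 (t : R) : 0 < Num.max t 3^-1 by rewrite lt_max invr_gt0 ltr0n orbT.
apply: sqrt_quad_modulus => [t|]; first by rewrite divr_ge0 ?clamp_ge0 // ltW.
apply: (@lipschitz_quad_modulus _ _ 18) => u t.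
have h1 := clamp_lipschitz u t.
have h2 : `|(Num.max u 3^-1)^-1 - (Num.max t 3^-1)^-1| <= 9 * `|u - t|.
  by rewrite (le_trans (inv_max_lipschitz _ _ _)) // -exprVn invrK -natrX.
have h3 : (Num.max t 3^-1)^-1 <= 3.
  by rewrite -[leRHS]invrK lef_pV2 ?posrE ?m0 ?invr_gt0 // le_max lexx orbT.
set b := (Num.max u _)^-1 in h2 *; set b' := (Num.max t _)^-1 in h2 h3 *.
have -> : clamp u * b - clamp t * b' = clamp u * (b - b') + (clamp u - clamp t) * b' by ring.
rewrite (le_trans (ler_normD _ _)) // !normrM.
rewrite (ger0_norm (clamp_ge0 _)) [X in _ + _ * X]ger0_norm ?invr_ge0 ?(ltW (m0 _)) //.
have -> : 18 * `|u - t| = 1 * (9 * `|u - t|) + (3 * `|u - t|) * 3 by ring.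
by rewrite lerD // ler_pM ?clamp_ge0 ?clamp_le1 ?invr_ge0 ?(ltW (m0 _)).
Qed.

End RealFunctions.
Arguments clamp {R} t.
Arguments inv_root {R} t.

Section StarHom.
Variables (R : realType) (A B : cstarAlgType R) (f : {linear A -> B}).
Hypothesis f_hom : is_star_hom f.

(** A star-homomorphism extends to the unitizations and maps inverses to inverses. *)
Lemma star_hom_spectrum a l : spectrum (f a) l -> spectrum a l.
Proof.
move=> /spectrumE h; apply/spectrumE => -[[u m] [uv vu]]; apply: h.
have [fM _] := f_hom; exists (f u, m).
have F (v w : unitz A) : ((f v.1, v.2) : unitz B) * (f w.1, w.2) =
    (f (v * w).1, (v * w).2).
  by congr (_, _); rewrite /= !linearD !linearZ fM.
have E : (emb (f a) - l%:A : unitz B) = (f (emb a - l%:A).1, (emb a - l%:A).2).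
  by congr (_, _); rewrite /= !scaler0 !subr0.
by rewrite E !(F _ (u, m)) !(F (u, m)) uv vu /= linear0.
Qed.

(** The norm of a self-adjoint element is seen by its spectrum, which can only shrink. *)
Lemma star_hom_nrm_le a : nrm (f a) <= nrm a.
Proof.
have [fM fS] := f_hom.
rewrite -(ler_pXn2r (ltn0Sn 1)) ?nnegrE ?nrm_ge0 // -!nrm_star_mul -fS -fM.
set h := star a ** a; have sh : self_adjoint h by rewrite /self_adjoint starM starK.
have sf : self_adjoint (f h) by rewrite /self_adjoint -fS sh.
have [t ft <-] := spectral_radius_sa sf.
exact/spectrum_bound/star_hom_spectrum.
Qed.

End StarHom.

Section Projections.
Variables (R : realType) (A : cstarAlgType R).
Implicit Types (c d e p q x y z v : A).

Lemma projection_nrm p : is_projection p -> p != 0 -> nrm p = 1.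
Proof.
move=> [pp sp] /nrm_gt0 p0; have := nrm_sa_sqr sp; rewrite pp => h.
by apply: (@mulfI _ (nrm p)); rewrite ?gt_eqF // mulr1 -expr2 -h.
Qed.

Lemma projection_nrm_le1 p : is_projection p -> nrm p <= 1.
Proof.
by move=> pp; have [->|p0] := eqVneq p 0; rewrite ?nrm0 // projection_nrm.
Qed.

Lemma projection_nrm_lt1 p : is_projection p -> nrm p < 1 -> p = 0.
Proof.
by move=> pp p1; apply/eqP; apply: contraTT p1 => /(projection_nrm pp) ->; rewrite ltxx.
Qed.

Lemma almost_idem_spectrum c (n t : R) : self_adjoint c ->
  nrm (c ** c - c) <= n -> spectrum c t%:C -> `|t * t - t| <= n.
Proof.
move=> sc cn ct; apply: le_trans cn.
have cid := is_funcalc_id c.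
exact: (funcalc_nrm_ge (is_funcalcB (is_funcalcM cid cid) cid)).
Qed.

(** Apply [clamp]: it is idempotent on the spectrum. The last clause, for bounded linear [T],
    says that the projection lies in the closed span of the powers of [c]; it transports
    invariance and orthogonality from [c] to the projection. *)
Lemma near_projection c (n : R) : self_adjoint c ->
  nrm (c ** c - c) <= n -> n < 2 / 9 ->
  exists e, [/\ is_projection e, nrm (e - c) <= 2 * n, is_funcalc clamp c e &
    forall (T : A -> A) (K : R), {morph T : x y / x + y} ->
      (forall l x, T (l *: x) = l *: T x) -> (forall x, nrm (T x) <= K * nrm x) ->
      (forall i, T (iter i (cmul c) c) = 0) -> T e = 0].
Proof.
move=> sc cn n1.
have clamp0 : clamp (0 : R) = 0 by rewrite clampE invr_ge0 ler0n.
have [e ce] := funcalc_exists sc (lipschitz_quad_modulus (@clamp_lipschitz R)) clamp0.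
have sp t (ct : spectrum c t%:C) := clamp_almost_idem (almost_idem_spectrum sc cn ct) n1.
exists e; split => //.
- split; last exact: funcalc_sa ce.
  apply: (funcalc_unique sc (is_funcalcM ce ce)); apply: is_funcalc_eq ce _ => t /sp[].
  by rewrite clampE; case: leP => // [|?]; rewrite ?mul0r //; case: leP; rewrite ?mul1r //; lra.
- by apply: (funcalc_dist sc ce (is_funcalc_id c)) => t /sp[].
- move=> T K TD TZ TK Tc.
  have T0 : T 0 = 0 by rewrite -[X in T X](scale0r (0 : A)) TZ scale0r.
  apply: (@funcalc_closed _ _ c [set x | T x = 0] _ _ ce).
    apply: closed_of_nrm => a h; apply: nrm_small_eq0 => d d0.
    have K1 : 0 < `|K| + 1 by rewrite ltr_wpDl.
    have [s Ts sa] := h _ (divr_gt0 d0 K1).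
    have -> : T a = T (a - s).
      by rewrite TD -scaleN1r TZ Ts scaler0 addr0.
    rewrite (le_trans (TK _)) // (@le_trans _ _ ((`|K| + 1) * nrm (a - s))) //.
      rewrite ler_wpM2r ?nrm_ge0 //; have := ler_norm K; lra.
    by rewrite mulrC -ler_pdivlMr // ltW.
  move=> P P0; rewrite /= /poly_eval (big_morph T TD T0) big1 // => i _.
  by rewrite TZ Tc scaler0.
Qed.

Lemma cuntz_conj v d x : cuntz_le d x -> cuntz_le (v ** d ** star v) x.
Proof.
move=> /cuntz_leP h; apply/cuntz_leP => e e0.
have K0 : 0 < nrm v * nrm v + 1 by rewrite ltr_wpDl // mulr_ge0 ?nrm_ge0.
have [w hw] := h _ (divr_gt0 e0 K0); exists (v ** w).
have -> : v ** d ** star v - v ** w ** x ** star (v ** w) =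
    v ** (d - w ** x ** star w) ** star v by rewrite cmulBr cmulBl starM !cmulA.
rewrite (le_lt_trans (nrmM _ _)) // nrm_star.
move: hw; rewrite ltr_pdivlMr //; apply: le_lt_trans.
rewrite (@le_trans _ _ (nrm v * nrm (d - w ** x ** star w) * nrm v)) //.
  rewrite ler_wpM2r ?nrm_ge0 // -!cmulA; exact: nrmM.
by rewrite mulrAC mulrC ler_wpM2l ?nrm_ge0 // lerDl.
Qed.

Lemma cutdown_conj c (e : R) : self_adjoint c -> 0 < e ->
  exists z, cutdown c e = z ** c ** star z.
Proof.
move=> sc e0.
have [||z cz] := @funcalc_exists _ _ (cutdown_root e) _ sc.
- exact: cutdown_root_quad_modulus.
- by rewrite /cutdown_root max_r ?ltW // mulfV ?gt_eqF // subrr sqrtr0.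
exists z; rewrite (funcalc_sa sc cz); apply: (funcalcE sc).
apply: is_funcalc_eq (is_funcalcM (is_funcalcM cz (is_funcalc_id c)) cz) _ => t _.
rewrite /= mulrAC -expr2 sqr_sqrtr; last first.
  rewrite subr_ge0 ler_pdivrMr ?lt_max ?e0 ?orbT // mul1r.
  by rewrite le_max lexx orbT.
case: (leP t e) => te; first by rewrite mulfV ?gt_eqF // subrr mul0r max_r // subr_le0.
rewrite max_l ?subr_ge0 ?ltW // mulrBl mul1r divfK // gt_eqF //; exact: lt_trans te.
Qed.

(** Where [t >= - k], the functions [max (t - eps) 0] and [t] differ by at most [k]. *)
Lemma cutdown_near_dist (c : A) (eps k : R) : self_adjoint c -> 0 < eps ->
  eps <= k -> (forall t : R, spectrum c t%:C -> - k <= t) ->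
  self_adjoint (cutdown c eps) /\ nrm (cutdown c eps - c) <= k.
Proof.
move=> sc e0 ek ct; pose f (t : R) := Num.max (t - eps) 0.
have [||d cd] := @funcalc_exists _ _ f _ sc.
- apply: (@lipschitz_quad_modulus _ _ 1) => u t; rewrite mul1r.
  rewrite (le_trans (max_lipschitz _ _ _)) // (_ : _ - _ - _ = u - t) //; ring.
- by rewrite /f sub0r max_r // oppr_le0 ltW.
rewrite /cutdown (funcalcE sc cd); split; first exact: funcalc_sa cd.
apply: (funcalc_dist sc cd (is_funcalc_id c)) => t /ct te; rewrite /f ler_norml.
by case: (leP (t - eps) 0) => ?; apply/andP; split; rewrite ?sub0r; lra.
Qed.

(** The compression [e ** d ** e] is almost idempotent, and its spectral projection
    is [e] itself: it is below [e] and at distance less than 1 from it. Hence [inv_root] of the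
    compression conjugates the compression to [e]. *)
Lemma cuntz_near_projection e d x : is_projection e -> self_adjoint d ->
  nrm (e - d) <= 8^-1 -> cuntz_le d x -> cuntz_le e x.
Proof.
move=> ep sd ed dx; have [ee se] := ep; pose m := e ** d ** e.
have sm : self_adjoint m by rewrite /self_adjoint /m !starM se sd cmulA.
have em : e ** m = m by rewrite /m !cmulA ee.
have e1 : nrm e <= 1 := projection_nrm_le1 ep.
have me : nrm (m - e) <= 8^-1.
  have -> : m - e = - (e ** (e - d) ** e).
    by rewrite cmulBr cmulBl !ee opprB.
  by rewrite nrmN (le_trans (nrm_mulr_le _ e1)) // (le_trans (nrm_mull_le _ e1)).
have m1 : nrm m <= 9 / 8 by have := nrm_sub_ge m e; lra.
have mm : nrm (m ** m - m) <= 9 / 64.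
  rewrite -{3}em -cmulBl (le_trans (nrmM _ _)) //.
  by have := nrm_ge0 m; have := nrm_ge0 (m - e); nra.
have [|e' [e'p e'm cm he]] := near_projection sm mm; first by lra.
have ee' : e ** e' = e'.
  apply/eqP; rewrite -subr_eq0; apply/eqP.
  apply: (he (fun x => e ** x - x) 2) => [u v|l u|u|i].
  - by rewrite cmulDr; module_ring.
  - by rewrite cmulZr scalerBr.
  - by rewrite (le_trans (nrmB _ _)) // mulrDl mul1r lerD // nrm_mull_le.
  - case: i => [|i] /=; first by rewrite em subrr.
    by rewrite cmulA em subrr.
have [e'e' se'] := e'p.
have e'e : e' ** e = e' by rewrite -[RHS]se' -[in RHS]ee' starM se se'.
(* [e - e'] is a projection of norm less than 1. *)
have E : e - e' = 0.
  apply: projection_nrm_lt1; first split.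
  - by rewrite cmulBl !cmulBr ee ee' e'e e'e' subrr subr0.
  - by rewrite starB se se'.
  - have := nrm_dist_tri m e e'; rewrite (nrm_distC e m) (nrm_distC m e'); lra.
have {E}E : e' = e by apply/esym/eqP; rewrite -subr_eq0 E.
have m0 (t : R) : 0 < Num.max t 3^-1 by rewrite lt_max invr_gt0 ltr0n orbT.
have [||z mz] := @funcalc_exists _ _ inv_root _ sm.
- exact: inv_root_quad_modulus.
- by rewrite /inv_root clampE invr_ge0 ler0n mul0r sqrtr0.
have zmz : is_funcalc clamp m (z ** m ** z).
  apply: is_funcalc_eq (is_funcalcM (is_funcalcM mz (is_funcalc_id m)) mz) _ => t mt.
  rewrite /= mulrAC -expr2 sqr_sqrtr; last by rewrite divr_ge0 ?clamp_ge0 // ltW.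
  rewrite clampE; case: (leP t) => t3; first by rewrite !mul0r.
  by rewrite divfK // gt_eqF // (lt_trans _ t3) // invr_gt0.
have eE : z ** m ** z = e by rewrite -(funcalc_unique sm cm zmz).
have -> : e = (z ** e) ** d ** star (z ** e).
  by rewrite starM se (funcalc_sa sm mz) -[LHS]eE /m !cmulA.
exact: cuntz_conj.
Qed.

End Projections.

(** * Almost orthogonal projections *)
Section OrthogonalProjections.
Variables (R : realType) (A : cstarAlgType R).

Lemma nrm_almost_idem (x : A) : self_adjoint x -> nrm (x ** x - x) <= 1 -> nrm x <= 2.
Proof.
move=> sx; have := nrm_sub_ge (x ** x) x; rewrite nrm_sa_sqr //.
have := nrm_ge0 x; move: (nrm x) (nrm (_ - _)) => *; nra.
Qed.

(** Compress [c] by the complement of [P] before taking the spectral projection. *)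
Lemma near_projection_orthogonal (P c : A) (k : R) :
  is_projection P -> self_adjoint c -> 200 * k <= 1 ->
  nrm (c ** c - c) <= k -> nrm (P ** c) <= k ->
  exists e, [/\ is_projection e, P ** e = 0 & nrm (e - c) <= 50 * k].
Proof.
move=> pP sc k1 cc Pc; have [PP sP] := pP; have P1 := projection_nrm_le1 pP.
have k0 : 0 <= k := le_trans (nrm_ge0 _) Pc.
have c2 : nrm c <= 2 by apply: nrm_almost_idem => //; lra.
pose c' := c - P ** c - c ** P + P ** c ** P.
have sc' : self_adjoint c'.
  by rewrite /self_adjoint /c' !(starD, starN, starM) sP sc cmulA; module_ring.
have Pc' : P ** c' = 0 by rewrite /c' !(cmulDr, cmulNr) !cmulA PP; module_ring.
have cP : nrm (c ** P) <= k by rewrite -nrm_star starM sP sc.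
have c'c : nrm (c' - c) <= 3 * k.
  have -> : c' - c = P ** c ** P - c ** P - P ** c by rewrite /c'; module_ring.
  have := nrmB (P ** c ** P - c ** P) (P ** c).
  have := nrmB (P ** c ** P) (c ** P); have := nrm_mulr_le (P ** c) P1.
  lra.
have c'3 : nrm c' <= 3 by have := nrm_sub_ge c' c; lra.
have nc' : nrm (c' ** c' - c') <= 20 * k.
  have -> : c' ** c' - c' =
      (c' - c) ** c' + c ** (c' - c) - (c' - c) + (c ** c - c).
    by rewrite cmulBl cmulBr; module_ring.
  have h1 := le_trans (nrmM _ _) (ler_pM (nrm_ge0 _) (nrm_ge0 _) c'c c'3).
  have h2 := le_trans (nrmM _ _) (ler_pM (nrm_ge0 _) (nrm_ge0 _) c2 c'c).
  have h3 := le_trans (nrmD _ _) (lerD h1 h2).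
  have h4 := le_trans (nrmB _ _) (lerD h3 c'c).
  by have := le_trans (nrmD _ _) (lerD h4 cc); lra.
have [|e [ep ec _ eT]] := near_projection sc' nc'; first by lra.
exists e; split => //; last by have := nrm_dist_tri c' e c; lra.
apply: (eT (fun x => P ** x) 1) => [x y|l x|x|n].
- exact: cmulDr.
- exact: cmulZr.
- by rewrite mul1r nrm_mull_le.
- by case: n => [|n] //=; rewrite cmulA Pc' cmul0l.
Qed.

(** Repair the projections one at a time, each against the sum of those already
    repaired. *)
Lemma near_orthogonal_projections (I : eqType) (s : seq I) (eps : R) :
  uniq s -> 0 < eps ->
  exists2 del : R, 0 < del & forall c : I -> A,
    (forall i, i \in s -> self_adjoint (c i) /\ nrm (c i ** c i - c i) <= del) ->
    (forall i j, i \in s -> j \in s -> i != j -> nrm (c i ** c j) <= del) ->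
  exists e : I -> A, [/\ forall i, i \in s -> is_projection (e i),
    forall i j, i \in s -> j \in s -> i != j -> e i ** e j = 0 &
    forall i, i \in s -> nrm (e i - c i) <= eps].
Proof.
elim: s eps => [|i0 s ih] eps /=; first by move=> _ _; exists 1 => // c _ _; exists c.
move=> /andP[i0s us] e0; pose N : R := (size s)%:R + 1.
have N1 : 1 <= N by rewrite lerDr.
have N0 : 0 < N by lra.
(* [k] meets the demands of [near_projection_orthogonal] and makes its error at most [eps]. *)
pose k := Num.min 1 eps / 200; have k0 : 0 < k by rewrite divr_gt0 // lt_min ltr01.
have ke : 200 * k <= eps by rewrite /k mulrC divfK // ge_min lexx orbT.
have k1 : 200 * k <= 1 by rewrite /k mulrC divfK // ge_min lexx.
pose eps1 := k / (4 * N); have eps10 : 0 < eps1 by rewrite divr_gt0 // mulr_gt0.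
have eps1N : N * eps1 = k / 4 by rewrite /eps1; field; rewrite gt_eqF.
have eps1k : eps1 <= k / 4 by rewrite -eps1N ler_peMl // ltW.
have [del1 del10 {}ih] := ih _ us eps10.
pose del := Num.min del1 (k / (2 * N)).
have del0 : 0 < del by rewrite lt_min del10 divr_gt0 // mulr_gt0.
have del_1 : del <= del1 by rewrite ge_min lexx.
have delN : N * del <= k / 2.
  rewrite (_ : k / 2 = N * (k / (2 * N))); last by field; rewrite gt_eqF.
  by rewrite ler_pM2l // ge_min lexx orbT.
have delk : del <= k / 2 by rewrite (le_trans _ delN) // ler_peMl // ltW.
exists del => // c c1 c2.
have [||e [ep eo ec]] := ih c.
- by move=> i si; have [|? /le_trans] := c1 i; rewrite ?inE ?si ?orbT //; split; auto.
- by move=> i j si sj ij; rewrite (le_trans (c2 i j _ _ ij)) // inE ?si ?sj orbT.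
have [s0 n0] := c1 _ (mem_head i0 s).
have c02 : nrm (c i0) <= 2 by apply: nrm_almost_idem => //; lra.
pose P := \sum_(i <- s) e i.
have eP i : i \in s -> e i ** P = e i.
  move=> si; rewrite cmul_sumr (bigD1_seq i) //= (ep i si).1 big_seq_cond.
  by rewrite big1 ?addr0 // => j /andP[sj ji]; rewrite eo // eq_sym.
have pP : is_projection P.
  split; last by rewrite star_sum big_seq [RHS]big_seq; apply: eq_bigr => i /ep[].
  by rewrite {1}/P cmul_suml big_seq [RHS]big_seq; apply: eq_bigr => i /eP.
have Pc : nrm (P ** c i0) <= k.
  rewrite cmul_suml (le_trans (nrm_sum _ _ _)) //.
  rewrite (@le_trans _ _ (\sum_(i <- s) (del + eps1 * 2))) //.
    rewrite big_seq [leRHS]big_seq; apply: ler_sum => i si.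
    rewrite -[e i](subrK (c i)) cmulDl addrC (le_trans (nrmD _ _)) // lerD //.
      by rewrite c2 ?inE ?si ?eqxx ?orbT //; apply: contraNneq i0s => <-.
    by rewrite (le_trans (nrmM _ _)) // ler_pM ?nrm_ge0 ?ec.
  rewrite big_const_seq count_predT iter_addr_0 -[leLHS]mulr_natl.
  rewrite (@le_trans _ _ (N * (del + eps1 * 2))) //; last by lra.
  by apply: ler_wpM2r; [lra|rewrite lerDl].
have [|e' [e'p Pe' e'c]] := near_projection_orthogonal pP s0 k1 _ Pc; first by lra.
have ee' i : i \in s -> e i ** e' = 0.
  by move=> si; rewrite -(eP i si) -cmulA Pe' cmul0r.
have e'e i : i \in s -> e' ** e i = 0.
  by move=> si; rewrite -[LHS]starK starM (ep i si).2 e'p.2 ee' ?star0.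
exists (fun i => if i == i0 then e' else e i); split => [i|i j|i]; rewrite !inE.
- by case: eqVneq => //= _; exact: ep.
- case: (eqVneq i) => [->|_] /=; case: (eqVneq j) => [->|_] //=; rewrite ?eqxx //.
  + by move=> _ sj _; exact: e'e.
  + by move=> si _ _; exact: ee'.
  + exact: eo.
- case: eqVneq => [-> _|_ /= si]; first by lra.
  by rewrite (le_trans (ec i si)) //; lra.
Qed.

End OrthogonalProjections.

(** * Rokhlin projections and an invariant projection *)
Section Positive.
Variables (R : realType) (A : cstarAlgType R).

(** The square of a real number is nonnegative, and the spectrum of [h] is real. *)
Lemma positive_sqr (h : A) : self_adjoint h -> positive (h ** h).
Proof.
move=> sh; split=> [|l]; first by rewrite /self_adjoint starM sh.
have X0 : ('X : {poly R})`_0 = 0 by rewrite coefX.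
rewrite -{1 2}(poly_evalX h) -poly_evalM // => hl.
have [|t _ ->] := spectrum_poly_eval sh _ hl; first by rewrite coefM big_ord1 X0 mul0r.
by rewrite ler0c hornerM hornerX -expr2 sqr_ge0.
Qed.

Lemma unit_positive_square (h : A) : self_adjoint h -> h != 0 ->
  exists x l, [/\ x = l *: (h ** h), positive x & nrm x = 1].
Proof.
move=> sh h0; pose l := ((nrm h)^-1)%:C : R[i].
exists ((l *: h) ** (l *: h)), (l * l); split.
- by rewrite cmulZl cmulZr scalerA.
- by apply: positive_sqr; rewrite /self_adjoint starZ conjc_real_complex sh.
- rewrite cmulZl cmulZr !nrmZR nrm_sa_sqr // ger0_norm ?invr_ge0 ?nrm_ge0 //.
  by rewrite expr2 mulrA mulrACA mulVf ?mulr1 ?mulVf ?gt_eqF ?nrm_gt0 ?nrm_ge0.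
Qed.

Lemma positive0 : positive (0 : A).
Proof. by rewrite -(cmul0l 0); apply: positive_sqr; exact: star0. Qed.

End Positive.

Section Rokhlin.
Variables (R : realType) (A : cstarAlgType R) (gT : finGroupType).
Variable alpha : cstar_action gT A.
Implicit Types (a x y p q : A) (g h : gT).

Lemma actM_mul g a b : alpha g (a ** b) = alpha g a ** alpha g b.
Proof. exact: (act_star_hom alpha g).1. Qed.

Lemma act_star g a : alpha g (star a) = star (alpha g a).
Proof. exact: (act_star_hom alpha g).2. Qed.

Lemma act_nrm g a : nrm (alpha g a) = nrm a.
Proof.
apply/eqP; rewrite eq_le (star_hom_nrm_le (act_star_hom alpha g)) /=.
by rewrite -{1}[a](Defs.act1 alpha) -(mulVg g) Defs.actM (star_hom_nrm_le (act_star_hom alpha _)).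
Qed.

Lemma rokhlin_nrm (F : seq A) (eps : R) x y : tracial_rokhlin alpha ->
  0 < eps -> positive x -> positive y -> nrm x = 1 ->
  exists pr : gT -> A,
    [/\ forall g, is_projection (pr g),
        forall g h, g != h -> pr g ** pr h = 0
      & let p := \sum_g pr g in
        [/\ forall a g, a \in F -> nrm (pr g ** a - a ** pr g) < eps,
            forall g h, nrm (alpha g (pr h) - pr (g * h)%g) < eps,
            cuntz_le (cutdown (y ** y - y ** p ** y) eps) x
          & 1 - eps < nrm (p ** x ** p)]].
Proof.
move=> rok e0 px py x1; have [|pr [pp po [h1 h2 h3 h4]]] := rok F eps x y e0 px py.
  by rewrite nrmE x1.
exists pr; split => //; split => // [a g aF|g h|].
- by rewrite -ltcR -nrmE h1.
- by rewrite -ltcR -nrmE h2.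
- by rewrite -ltcR -nrmE.
Qed.

Lemma card_group_ge1 : 1 <= #|gT|%:R :> R.
Proof. by rewrite ler1n; apply/card_gt0P; exists 1%g. Qed.

Lemma sum_projection (pr : gT -> A) : (forall g, is_projection (pr g)) ->
  (forall g h, g != h -> pr g ** pr h = 0) ->
  is_projection (\sum_g pr g) /\ forall g, pr g ** (\sum_h pr h) = pr g.
Proof.
move=> pp po; have pP g : pr g ** (\sum_h pr h) = pr g.
  rewrite cmul_sumr (bigD1 g) //= (pp g).1 big1 ?addr0 // => h hg.
  by rewrite po // eq_sym.
split=> //; split; first by rewrite cmul_suml; apply: eq_bigr => g _.
by rewrite star_sum; apply: eq_bigr => g _; exact: (pp g).2.
Qed.

(** The sum [p] of the Rokhlin projections is almost invariant, since the action permutes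
    them up to a small error. Its average over the group is exactly invariant and still almost
    idempotent, so the nearby projection is invariant as well. It is nonzero because [p] is. *)
Lemma invariant_projection : tracial_rokhlin alpha -> (exists a : A, a != 0) ->
  exists q, [/\ is_projection q, q != 0 & forall g, alpha g q = q].
Proof.
move=> rok [a a0]; pose h := a ** star a.
have sh : self_adjoint h by rewrite /self_adjoint starM starK.
have h0 : h != 0 by exact: mul_star_neq0.
have [x [_ [_ px x1]]] := unit_positive_square sh h0.
pose N : R := #|gT|%:R.
have N1 : 1 <= N by exact: card_group_ge1.
have N0 : 0 < N by lra.
(* The [N] errors add up to 1/100. *)
pose eps := (100 * N)^-1; have e0 : 0 < eps by rewrite invr_gt0 mulr_gt0.
have eN : N * eps = 100^-1 by rewrite /eps; field; rewrite gt_eqF.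
have [pr [pp po /=]] := rokhlin_nrm [::] rok e0 px (positive0 A) x1.
have [] := sum_projection pp po; set p := \sum_g pr g => pproj _ [_ aprox _ pxp].
have p1 : nrm p <= 1 := projection_nrm_le1 pproj.
have ap g : nrm (alpha g p - p) <= 100^-1.
  have -> : alpha g p - p = \sum_h (alpha g (pr h) - pr (g * h)%g).
    by rewrite sumrB linear_sum; congr (_ - _); exact: (reindex_inj (mulgI g)).
  by rewrite -eN; apply: nrm_sum_le => h1; rewrite ltW.
pose c := (N^-1)%:C *: \sum_g alpha g p.
have sc : self_adjoint c.
  rewrite /self_adjoint starZ conjc_real_complex star_sum; congr (_ *: _).
  by apply: eq_bigr => g _; rewrite -act_star pproj.2.
have cp : nrm (c - p) <= 100^-1.
  have -> : c - p = (N^-1)%:C *: \sum_g (alpha g p - p).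
    rewrite sumrB sumr_const scalerBr; congr (_ - _).
    rewrite -scaler_nat scalerA -(rmorph_nat (real_complex R)) -rmorphM /=.
    by rewrite mulVf ?gt_eqF // scale1r.
  rewrite nrmZR ger0_norm ?invr_ge0 ?(ltW N0) // ler_pdivrMl //.
  exact: nrm_sum_le.
have c2 : nrm c <= 2 by have := nrm_sub_ge c p; lra.
have cc : nrm (c ** c - c) <= 20^-1.
  have -> : c ** c - c = (c - p) ** c + p ** (c - p) - (c - p).
    by rewrite cmulBl cmulBr pproj.1; module_ring.
  have h1 := le_trans (nrmM _ _) (ler_pM (nrm_ge0 _) (nrm_ge0 _) cp c2).
  have h2 := le_trans (nrm_mull_le _ p1) cp.
  by have := le_trans (nrmB _ _) (lerD (le_trans (nrmD _ _) (lerD h1 h2)) cp); lra.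
have [|q [qp qc _ qT]] := near_projection sc cc; first by lra.
exists q; split => // [|g].
  apply/eqP => q0; have pp1 : nrm p < 1.
    have := nrm_dist_tri c p q; rewrite {1}q0 subr0 (nrm_distC p c) (nrm_distC c q); lra.
  move: pxp; rewrite (projection_nrm_lt1 pproj pp1) cmul0r nrm0.
  have : eps <= N * eps by rewrite ler_peMl // ltW.
  lra.
have ac : alpha g c = c.
  rewrite /c linearZ linear_sum /=; congr (_ *: _); rewrite [RHS](reindex_inj (mulgI g)).
  by apply: eq_bigr => k _; rewrite Defs.actM.
apply/eqP; rewrite -subr_eq0; apply/eqP.
apply: (qT (fun x => alpha g x - x) 2) => [u v|l u|u|i].
- by rewrite linearD /=; module_ring.
- by rewrite linearZ /= scalerBr.
- by rewrite (le_trans (nrmB _ _)) // act_nrm mulrDl mul1r.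
- by apply/eqP; rewrite subr_eq0; apply/eqP; elim: i => //= i ih; rewrite actM_mul ih ac.
Qed.

End Rokhlin.

(** * Compression to a corner *)
Section Compression.
Variables (R : realType) (A : cstarAlgType R) (q : projection A).
Implicit Types (x y a : corner q) (b p : A).

Lemma corner_mull x : q ** val x = val x.
Proof.
case: x => x /eqP xE /=; rewrite -xE !cmulA.
by have [-> _] := projP q.
Qed.

Lemma corner_mulr x : val x ** q = val x.
Proof.
case: x => x /eqP xE /=; rewrite -xE -!cmulA.
by have [-> _] := projP q.
Qed.

Lemma compress_subproof b : q ** b ** q \in corner_pred q.
Proof. by apply/eqP; have [qq _] := projP q; rewrite !cmulA qq -!cmulA qq. Qed.

Definition compress b : corner q := Corner (compress_subproof b).

Lemma compressB b c : compress (b - c) = compress b - compress c.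
Proof. by apply: val_inj; rewrite /= cmulBr cmulBl. Qed.

Lemma compress_sum (I : finType) (F : I -> A) :
  compress (\sum_i F i) = \sum_i compress (F i).
Proof.
apply: val_inj; rewrite (big_morph val (id1 := 0) (op1 := +%R)) //=.
by rewrite cmul_sumr cmul_suml.
Qed.

Lemma compress_val x : compress (val x) = x.
Proof. by apply: val_inj; rewrite /= corner_mull corner_mulr. Qed.

Lemma compress_star b : star (compress b) = compress (star b).
Proof. by apply: val_inj; have [_ sq] := projP q; rewrite /= !starM sq cmulA. Qed.

Lemma compress_mull x b : compress (val x ** b) = x ** compress b.
Proof. by apply: val_inj; rewrite /= !cmulA corner_mull corner_mulr. Qed.

Lemma compress_mulr b x : compress (b ** val x) = compress b ** x.
Proof. by apply: val_inj; rewrite /= -!cmulA corner_mull corner_mulr. Qed.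

Lemma compress_unitl x : compress q ** x = x.
Proof.
by apply: val_inj; have [qq _] := projP q; rewrite /= !qq corner_mull.
Qed.

Lemma compress_unitr x : x ** compress q = x.
Proof.
by apply: val_inj; have [qq _] := projP q; rewrite /= !qq corner_mulr.
Qed.

Lemma corner_nrmE x : nrm x = nrm (val x). Proof. by []. Qed.

Lemma compress_nrm_le b : nrm (compress b) <= nrm b.
Proof.
have q1 := projection_nrm_le1 (projP q).
by rewrite (le_trans (nrm_mulr_le _ q1)) // nrm_mull_le.
Qed.

Lemma compress_mul_near b c (k : R) :
  nrm b <= 1 -> nrm (c ** q - q ** c) <= k ->
  nrm (compress b ** compress c - compress (b ** c)) <= k.
Proof.
move=> b1 ck; have [qq _] := projP q.
have -> : compress b ** compress c - compress (b ** c) =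
    - compress (b ** (c ** q - q ** c)).
  apply: val_inj; rewrite /= !(cmulBr, cmulBl) !cmulA -(cmulA _ q q) qq.
  by rewrite -(cmulA _ q q) qq opprB.
by rewrite nrmN (le_trans (compress_nrm_le _)) // (le_trans (nrm_mull_le _ b1)).
Qed.

Lemma val_is_star_hom : is_star_hom (val : {linear corner q -> A}).
Proof. by []. Qed.

Lemma val_positive x : positive x -> positive (val x).
Proof.
move=> [sx xp]; split; first exact: congr1 sx.
by move=> l xl; apply: xp; exact: (star_hom_spectrum val_is_star_hom).
Qed.

Lemma cuntz_corner a x : cuntz_le (val a) (val x) -> cuntz_le a x.
Proof.
move=> /cuntz_leP h; apply/cuntz_leP => e /h[v av]; exists (compress v).
rewrite (le_lt_trans _ av) // corner_nrmE raddfB /=.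
have [_ sq] := projP q.
have -> : val a - q ** v ** q ** val x ** star (q ** v ** q) =
    q ** (val a - v ** val x ** star v) ** q.
  rewrite cmulBr cmulBl corner_mull corner_mulr !starM sq; congr (_ - _).
  by rewrite -[val x in RHS]corner_mull -[val x in RHS]corner_mulr !cmulA.
exact: compress_nrm_le.
Qed.

(** In the corner, the complement of [P] is close to the compression of the
    complement of [p], whose cut-down is Cuntz below [x]; a projection is Cuntz below
    whatever is close to it. *)
Lemma compress_complement_cuntz p (P x : corner q) (eps k : R) :
  is_projection p -> is_projection P -> 0 < eps -> eps <= k ->
  nrm (p ** q - q ** p) <= k -> nrm (P - compress p) + k <= 8^-1 ->
  cuntz_le (cutdown (q ** q - q ** p ** q) eps) (val x) ->
  is_projection (compress q - P) /\ cuntz_le (compress q - P) x.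
Proof.
move=> pp pP e0 ek pq Pk cun; have [qq sq] := projP q; have [PP sP] := pP.
pose E := compress q - P; pose c := compress ((q : A) - p).
have p1 := projection_nrm_le1 pp.
have pE : is_projection E.
  split; first rewrite /E !(cmulBl, cmulBr) !compress_unitl compress_unitr PP.
    by rewrite subrr subr0.
  by rewrite starB sP compress_star sq.
have cE : val c = q ** q - q ** p ** q by rewrite /= cmulBr cmulBl !qq.
have sc : self_adjoint (val c).
  by rewrite /self_adjoint cE starB !starM sq pp.2 cmulA.
have cc : nrm (val c ** val c - val c) <= k.
  rewrite (_ : nrm _ = nrm (c ** c - c)) //.
  have -> : c ** c - c = compress p ** compress p - compress p.
    rewrite /c compressB !(cmulBl, cmulBr) !compress_unitl compress_unitr.
    by module_ring.
  by have := compress_mul_near p1 pq; rewrite pp.1.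
have cs (s : R) : spectrum (val c) s%:C -> - k <= s.
  move=> /(almost_idem_spectrum sc cc); rewrite ler_norml => /andP[_].
  by have := sqr_ge0 s; rewrite expr2; move: (s * s) => *; lra.
have [sd dc] := cutdown_near_dist sc e0 ek cs.
split=> //; apply: cuntz_corner; move: cun; rewrite -cE.
apply: cuntz_near_projection sd _.
  by have [EE sE] := pE; split; [exact: congr1 EE|exact: congr1 sE].
have := nrm_dist_tri (val c) (val E) (cutdown (val c) eps).
rewrite (nrm_distC (val c)); have -> : nrm (val E - val c) = nrm (P - compress p).
  rewrite -nrmN; congr nrm; suff : - (E - c) = P - compress p by move/(congr1 val).
  by rewrite /E /c compressB; module_ring.
by lra.
Qed.

(** Replace [p] by [q ** p ** q] and then by [P] on each side of [x], one side at a time. *)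
Lemma compress_nrm_ge p (P x : corner q) (k k' : R) :
  is_projection p -> is_projection P -> nrm x = 1 ->
  nrm (p ** q - q ** p) <= k -> nrm (P - compress p) <= k' ->
  nrm (p ** val x ** p) <= nrm (P ** x ** P) + 2 * k + 2 * k'.
Proof.
move=> pp pP x1 pq Pk; have [qq sq] := projP q; have [PP sP] := pP.
pose m := q ** p ** q.
have p1 := projection_nrm_le1 pp; have q1 := projection_nrm_le1 (projP q).
have P1 : nrm (val P) <= 1 := projection_nrm_le1 pP.
have m1 : nrm m <= 1 by exact: le_trans (compress_nrm_le p) p1.
have sm : star m = m by rewrite /m !starM sq pp.2 cmulA.
have bd (u v : A) (ku kv : R) : nrm u <= ku -> nrm v <= kv ->
    nrm (u ** val x ** v) <= ku * kv.
  move=> hu hv; rewrite (le_trans (nrmM _ _)) // ler_pM ?nrm_ge0 //.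
  by rewrite (le_trans _ hu) // nrm_mulr_le // -corner_nrmE x1.
have um : nrm (p ** q - m) <= k.
  have -> : p ** q - m = (p ** q - q ** p) ** q by rewrite cmulBl -(cmulA p) qq.
  by rewrite (le_trans (nrm_mulr_le _ q1)).
have um' : nrm (q ** p - m) <= k by rewrite -nrm_star starB starM sm pp.2 sq.
have qp1 : nrm (q ** p) <= 1 by rewrite (le_trans (nrm_mulr_le _ p1)).
have mP : nrm (m - val P) <= k' by rewrite nrm_distC.
have -> : p ** val x ** p = (p ** q - m) ** val x ** (q ** p)
    + m ** val x ** (q ** p - m) + (m - val P) ** val x ** m
    + val P ** val x ** (m - val P) + val P ** val x ** val P.
  rewrite !(cmulBl, cmulBr).
  have -> : p ** q ** val x ** (q ** p) = p ** val x ** p.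
    by rewrite -(cmulA p) corner_mull !cmulA -(cmulA p) corner_mulr.
  by module_ring.
have h1 := le_trans (nrmD _ _) (lerD (bd _ _ _ _ um qp1) (bd _ _ _ _ m1 um')).
have h2 := le_trans (nrmD _ _) (lerD h1 (bd _ _ _ _ mP m1)).
have h3 := le_trans (nrmD _ _) (lerD h2 (bd _ _ _ _ P1 mP)).
by have := le_trans (nrmD _ _) (lerD h3 (lexx (nrm (val P ** val x ** val P)))); lra.
Qed.

End Compression.

(** * The action on an invariant corner *)

Section CornerAction.
Variables (R : realType) (A : cstarAlgType R) (gT : finGroupType).
Variables (alpha : cstar_action gT A) (q : projection A).
Hypothesis alpha_q : forall g, alpha g (q : A) = (q : A).
Implicit Types (x y a : corner q) (g h : gT).

Lemma corner_act_subproof g x : alpha g (val x) \in corner_pred q.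
Proof.
apply/eqP; rewrite -{1 2}(alpha_q g) -!actM_mul; congr (alpha g _).
by case: x => x /= /eqP.
Qed.

Definition corner_act g x : corner q := Corner (corner_act_subproof g x).

Fact corner_act_linear g : linear (corner_act g).
Proof. by move=> l x y; apply: val_inj; rewrite /= linearP. Qed.

HB.instance Definition _ g :=
  GRing.isLinear.Build R[i] (corner q) (corner q) _ (corner_act g)
    (corner_act_linear g).

Fact corner_act_star_hom g : is_star_hom (corner_act g : {linear _ -> _}).
Proof.
split=> [x y|x]; apply: val_inj; first exact: actM_mul.
exact: act_star.
Qed.

Fact corner_act1 x : corner_act 1%g x = x.
Proof. by apply: val_inj; exact: Defs.act1. Qed.

Fact corner_actM g h x : corner_act (g * h)%g x = corner_act g (corner_act h x).
Proof. by apply: val_inj; exact: Defs.actM. Qed.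

Definition corner_action : cstar_action gT (corner q) :=
  CStarAction corner_act_star_hom corner_act1 corner_actM.

Lemma corner_act_compress g b : corner_act g (compress q b) = compress q (alpha g b).
Proof. by apply: val_inj; rewrite /= !actM_mul alpha_q. Qed.

(** The compressions of the Rokhlin projections are close to mutually orthogonal projections
    of the corner. The property of [A] is used with its second positive element equal to [q]: this
    makes the complement of the repaired projections Cuntz below [x], and every
    [y] of the corner then conjugates that complement to an element Cuntz below [x]. *)
Lemma corner_rokhlin : tracial_rokhlin alpha -> tracial_rokhlin corner_action.
Proof.
move=> rok F eps x y e0 px py; rewrite nrmE => /complexI x1.
have [qq sq] := projP q.
pose M : R := 1 + \sum_(a <- F) nrm a.
have M1 : 1 <= M by rewrite lerDl sumr_ge0 // => a _; exact: nrm_ge0.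
have FM a : a \in F -> nrm a <= M.
  move=> aF; rewrite /M (big_rem a) //= addrCA lerDl addr_ge0 //.
  by rewrite sumr_ge0 // => b _; exact: nrm_ge0.
pose N : R := #|gT|%:R; have N1 : 1 <= N := card_group_ge1 R gT.
have N0 : 0 <= N by lra.
have M0 : 0 <= M by lra.
pose t := Num.min 1 eps.
have t0 : 0 < t by rewrite lt_min ltr01.
have te : t <= eps by rewrite ge_min lexx orbT.
have t1 : t <= 1 by rewrite ge_min lexx.
(* [eps2] bounds the repair of each projection. It is to absorb the [N] group elements and
   the norms of the elements of [F]. *)
pose eps2 := t / (16 * N * M).
have eps20 : 0 < eps2 by rewrite divr_gt0 // !mulr_gt0 //; lra.
have eps2E : N * M * eps2 = t / 16 by rewrite /eps2; field; rewrite !gt_eqF //; lra.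
have eps2N : N * eps2 <= t / 16.
  by rewrite -eps2E mulrAC ler_peMr // mulr_ge0 ?(ltW eps20).
have eps2M : M * eps2 <= t / 16.
  by rewrite -eps2E -mulrA ler_peMl // mulr_ge0 ?(ltW eps20).
have eps2t : eps2 <= t / 16.
  by rewrite (le_trans _ eps2M) // ler_peMl ?(ltW eps20).
have [del del0 orth] := near_orthogonal_projections (corner q) (enum_uniq gT) eps20.
pose eps3 := Num.min del eps2.
have eps30 : 0 < eps3 by rewrite lt_min del0.
have eps3d : eps3 <= del by rewrite ge_min lexx.
have eps32 : eps3 <= eps2 by rewrite ge_min lexx orbT.
have eps3N : eps3 <= N * eps3 by rewrite ler_peMl ?(ltW eps30).
have N23 : N * eps3 <= N * eps2 by rewrite ler_wpM2l.
have pq : positive (q : A) by rewrite -qq; exact: positive_sqr.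
have [pr [pp po /=]] :=
  rokhlin_nrm (proj_val q :: map val F) rok eps30 (val_positive px) pq x1.
have [] := sum_projection pp po; set p := \sum_g pr g.
move=> pproj _ [comm equiv cun pxp].
have commq g : nrm (pr g ** q - q ** pr g) <= eps3 by rewrite ltW // comm ?mem_head.
have pr1 g : nrm (pr g) <= 1 := projection_nrm_le1 (pp g).
pose c g := compress q (pr g).
have [||e [ep eo ec]] := orth c.
- move=> g _; split; first by rewrite /self_adjoint compress_star (pp g).2.
  by have := compress_mul_near (pr1 g) (commq g); rewrite (pp g).1 => /le_trans; apply.
- move=> g h _ _ gh; have := compress_mul_near (pr1 g) (commq h).
  rewrite po // (_ : compress q 0 = 0) ?subr0 => [/le_trans|]; first exact.
  by apply: val_inj; rewrite /= cmul0r cmul0l.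
have {}ep g : is_projection (e g) by apply: ep; rewrite mem_enum.
have {}eo g h : g != h -> e g ** e h = 0 by apply: eo; rewrite mem_enum.
have {}ec g : nrm (e g - c g) <= eps2 by apply: ec; rewrite mem_enum.
exists e; split => //; have [] := sum_projection ep eo; set P := \sum_g e g.
move=> Pproj _ /=.
have Pm : nrm (P - compress q p) <= N * eps2.
  by rewrite compress_sum -sumrB; exact: nrm_sum_le.
have commp : nrm (p ** q - q ** p) <= N * eps3.
  have -> : p ** q - q ** p = \sum_g (pr g ** q - q ** pr g).
    by rewrite cmul_sumr cmul_suml sumrB.
  exact: nrm_sum_le.
split.
- move=> a g aF; rewrite nrmE ltcR.
  have -> : e g ** a - a ** e g =
      ((e g - c g) ** a - a ** (e g - c g)) + (c g ** a - a ** c g).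
    by rewrite cmulBl cmulBr; module_ring.
  have cga : nrm (c g ** a - a ** c g) < eps3.
    rewrite -compress_mulr -compress_mull -compressB.
    by rewrite (le_lt_trans (compress_nrm_le q _)) // comm // inE map_f ?orbT.
  have k1 := le_trans (nrmM _ _) (ler_pM (nrm_ge0 _) (nrm_ge0 _) (ec g) (FM a aF)).
  have k2 := le_trans (nrmM _ _) (ler_pM (nrm_ge0 _) (nrm_ge0 _) (FM a aF) (ec g)).
  have k3 := lerD (le_trans (nrmB _ _) (lerD k1 k2)) (lexx (nrm (c g ** a - a ** c g))).
  rewrite (le_lt_trans (nrmD _ _)) // (le_lt_trans k3) //.
  by clear -cga eps2M eps2t eps32 t0 te alpha_q; lra.
- move=> g h; rewrite nrmE ltcR.
  have -> : corner_action g (e h) - e (g * h)%g = corner_act g (e h - c h)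
       + (corner_act g (c h) - c (g * h)%g) - (e (g * h)%g - c (g * h)%g).
    by rewrite linearB /=; module_ring.
  have k1 : nrm (corner_act g (e h - c h)) <= eps2.
    by rewrite (act_nrm corner_action).
  have k2 : nrm (corner_act g (c h) - c (g * h)%g) <= eps3.
    by rewrite corner_act_compress -compressB (le_trans (compress_nrm_le q _)) // ltW.
  have k3 := le_trans (nrmB _ _) (lerD (le_trans (nrmD _ _) (lerD k1 k2)) (ec (g * h)%g)).
  by rewrite (le_lt_trans k3) //; clear -eps2t eps32 t0 te alpha_q; lra.
- have Pk : nrm (P - compress q p) + N * eps3 <= 8^-1.
    by clear -Pm N23 eps2N t1 alpha_q; lra.
  have [pE Ex] := compress_complement_cuntz pproj Pproj eps30 eps3N commp Pk cun.
  have [sy _] := py.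
  have yE : y ** y - y ** P ** y = y ** (compress q q - P) ** y.
    by rewrite cmulBr cmulBl compress_unitr.
  have syE : self_adjoint (y ** (compress q q - P) ** y).
    by rewrite /self_adjoint !starM sy pE.2 cmulA.
  rewrite yE; have [z ->] := cutdown_conj syE e0.
  rewrite (_ : z ** _ ** star z = (z ** y) ** (compress q q - P) ** star (z ** y)).
    exact: cuntz_conj.
  by rewrite starM sy !cmulA.
- rewrite nrmE ltcR; have := compress_nrm_ge pproj Pproj x1 commp Pm.
  by clear -pxp N23 eps2N eps32 eps2t te t0 alpha_q; lra.
Qed.

End CornerAction.

(** * Ideals of the crossed product *)
Section CrossedProduct.
Variables (R : realType) (A B : cstarAlgType R) (gT : finGroupType).
Variable alpha : cstar_action gT A.
Implicit Types (a b c : A) (g h k : gT) (f : {ffun gT -> A}).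

Definition delta g a : {ffun gT -> A} := [ffun h => if h == g then a else 0].

Fact delta_linear g : linear (delta g).
Proof.
move=> l a b; apply/ffunP => h; rewrite !ffunE.
by case: eqP => // _; rewrite scaler0 addr0.
Qed.

HB.instance Definition _ g :=
  GRing.isLinear.Build R[i] A {ffun gT -> A} _ (delta g) (delta_linear g).

Lemma sum_delta f : f = \sum_g delta g (f g).
Proof.
apply/ffunP => h; rewrite sum_ffunE (bigD1 h) //= ffunE eqxx big1 ?addr0 //.
by move=> g gh; rewrite ffunE eq_sym (negbTE gh).
Qed.

Lemma conv_delta f k c h :
  twisted_conv alpha f (delta k c) h = f (h * k^-1)%g ** alpha (h * k^-1)%g c.
Proof.
rewrite ffunE (bigD1 (h * k^-1)%g) //= ffunE invMg invgK mulgKV eqxx big1 ?addr0 //.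
move=> i ih; rewrite ffunE ifF ?linear0 ?cmul0r //; apply: contraNF ih => /eqP <-.
by rewrite invMg invgK mulgA mulgV mul1g.
Qed.

Lemma delta_conv f c h : twisted_conv alpha (delta 1%g c) f h = c ** f h.
Proof.
rewrite ffunE (bigD1 1%g) //= ffunE eqxx invg1 mul1g Defs.act1 big1 ?addr0 //.
by move=> i i1; rewrite ffunE (negbTE i1) cmul0l.
Qed.

Variable j : {linear {ffun gT -> A} -> B}.
Hypothesis j_bij : bijective j.
Hypothesis jM : forall f f', j (twisted_conv alpha f f') = j f ** j f'.
Hypothesis jS : forall f, j (twisted_star alpha f) = star (j f).

(** The element [a u_g] of the crossed product. *)
Definition single g : A -> B := j \o delta g.
HB.instance Definition _ g := GRing.Linear.on (single g).

Lemma single_mul g h a b : single g a ** single h b = single (g * h)%g (a ** alpha g b).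
Proof.
rewrite /single /= -jM; congr (j _); apply/ffunP => k; rewrite conv_delta !ffunE.
rewrite -(inj_eq (mulIg h)) mulgKV; case: eqP => [->|]; first by rewrite mulgK.
by rewrite cmul0l.
Qed.

Lemma single_star g a : star (single g a) = single g^-1%g (alpha g^-1%g (star a)).
Proof.
rewrite /single /= -jS; congr (j _); apply/ffunP => k; rewrite !ffunE.
rewrite -[k == _](inj_eq invg_inj) invgK; case: eqP => [<-|]; first by rewrite invgK.
by rewrite star0 linear0.
Qed.

Lemma sum_single f : j f = \sum_g single g (f g).
Proof. by rewrite {1}[f]sum_delta linear_sum. Qed.

Lemma single1_is_star_hom : is_star_hom (single 1%g : {linear A -> B}).
Proof.
split=> [a b|a]; first by rewrite single_mul mul1g Defs.act1.
by rewrite single_star invg1 Defs.act1.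
Qed.

Lemma single_nrm_le g a : nrm (single g a) <= nrm a.
Proof.
rewrite -(ler_pXn2r (ltn0Sn 1)) ?nnegrE ?nrm_ge0 // -!nrm_mul_star single_star.
rewrite single_mul mulgV -Defs.actM mulgV Defs.act1.
exact: (star_hom_nrm_le single1_is_star_hom).
Qed.

Lemma single_inj g : injective (single g).
Proof.
move=> a b /(bij_inj j_bij) /ffunP /(_ g); by rewrite !ffunE eqxx.
Qed.

Section Simple.
Hypothesis A_simple : cstar_simple A.
Variable I : set B.
Hypothesis I_ideal : closed_ideal I.

Let I0 : I 0. Proof. by case: I_ideal. Qed.
Let IZ l x y : I x -> I y -> I (l *: x + y).
Proof. by case: I_ideal => _ _ + _ _; exact. Qed.
Let IMl (b x : B) : I x -> I (b ** x). Proof. by case: I_ideal => _ _ _ + _; exact. Qed.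
Let IMr (b x : B) : I x -> I (x ** b). Proof. by case: I_ideal => _ _ _ _; exact. Qed.

Lemma ideal_scale l x : I x -> I (l *: x).
Proof. by move=> Ix; rewrite -[_ *: _]addr0; exact: IZ. Qed.

Lemma ideal_add x y : I x -> I y -> I (x + y).
Proof. by move=> Ix Iy; rewrite -[x]scale1r; exact: IZ. Qed.

Lemma ideal_sum (J : finType) (F : J -> B) : (forall i, I (F i)) -> I (\sum_i F i).
Proof. by move=> IF; elim/big_ind: _ => // x y; exact: ideal_add. Qed.

(** Multiplying the coefficient at [g] by [a] on the right is multiplying in the crossed
    product by the element of [A] that [g] carries to [a]. *)
Lemma ideal_coefficients g : closed_ideal [set a | I (single g a)].
Proof.
have [clI _ _ _ _] := I_ideal; split.
- apply: closed_of_nrm => a h; apply: (closed_nrmP clI) => e /h[s Is sa].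
  exists (single g s) => //.
  by rewrite -linearB (le_lt_trans (single_nrm_le _ _)).
- by rewrite /= linear0.
- by move=> l x y Ix Iy; rewrite /= linearP; exact: IZ.
- move=> a x Ix /=; have := IMl (single 1%g a) Ix.
  by rewrite single_mul mul1g Defs.act1.
- move=> a x Ix /=; have := IMr (single 1%g (alpha g^-1%g a)) Ix.
  by rewrite single_mul mulg1 -Defs.actM mulgV Defs.act1.
Qed.

(** The coefficients at [g] of the ideal form an ideal of [A], which is everything as soon as it
    is nonzero; multiplying by [single g (star a)] carries a
    nonzero coefficient from the unit to [g]. *)
Lemma ideal_setT : (exists2 a, a != 0 & I (single 1%g a)) -> I = setT.
Proof.
move=> [a a0 Ia]; have [_ simpleA] := A_simple.
have JT g : (exists2 c, c != 0 & I (single g c)) -> forall c, I (single g c).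
  move=> [c c0 Ic]; 
  have [/seteqP[/(_ c Ic)/= c0' _]|/seteqP[_ h] x] := simpleA _ (ideal_coefficients g).
    by rewrite c0' eqxx in c0.
  exact: h.
have {}Ia := JT 1%g (ex_intro2 _ _ a a0 Ia).
apply/seteqP; split=> // b _; have [j' _ jK] := j_bij; rewrite -[b]jK sum_single.
apply: ideal_sum => g; apply: JT; exists (a ** star a).
  exact: mul_star_neq0.
have := IMr (single g (star a)) (Ia a).
by rewrite single_mul mul1g Defs.act1.
Qed.

(** Multiplying on the right by [single g^-1] of a suitable element moves a nonzero coefficient
    [f g] to the unit, where it becomes [w = f g ** star (f g)]; multiplying by [w] on the
    left makes it the square of a self-adjoint element, which is positive. *)
Lemma ideal_unit_coefficient : (exists2 b, b != 0 & I b) ->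
  exists f, [/\ I (j f), positive (f 1%g) & nrm (f 1%g) = 1].
Proof.
move=> [b b0 Ib]; have [j' _ jK] := j_bij; move: b0 Ib; rewrite -[b]jK.
move: (j' b) => f f0 If; have [g fg] : exists g, f g != 0.
  apply: contrapT => nf; case/eqP: f0; have -> : f = 0; last by rewrite linear0.
  apply/ffunP => g; rewrite ffunE; apply/eqP; apply: contrapT => /negP fg.
  by apply: nf; exists g.
pose w := f g ** star (f g).
have sw : self_adjoint w by rewrite /self_adjoint starM starK.
have w0 : w != 0 by exact: mul_star_neq0.
have [x [l [xE px x1]]] := unit_positive_square sw w0.
pose f' := twisted_conv alpha (delta 1%g w)
  (twisted_conv alpha f (delta g^-1%g (alpha g^-1%g (star (f g))))).
have f'1 : f' 1%g = w ** w.
  rewrite /f' delta_conv conv_delta invgK mul1g -Defs.actM mulgV Defs.act1 //.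
exists (l *: f'); rewrite ffunE f'1 -xE; split => //.
by rewrite linearZ /= !jM; apply: ideal_scale; apply: IMl; exact: IMr.
Qed.

(** Compressing by each Rokhlin projection and summing turns the coefficient [x] at the unit into
    almost [p ** x ** p] and almost kills the others: [p_g] almost commutes
    with [f h] and is orthogonal to [p_(h g)], which is close to the image of [p_g] under [h]. *)
Lemma rokhlin_average f (eps : R) : tracial_rokhlin alpha -> 0 < eps -> I (j f) ->
  positive (f 1%g) -> nrm (f 1%g) = 1 ->
  exists y z, [/\ self_adjoint y, I z, nrm y <= 1, 1 - eps < nrm y &
    nrm (single 1%g y - z) <= eps].
Proof.
move=> rok e0 If px x1; set x := f 1%g in px x1 *.
pose M : R := 1 + \sum_g nrm (f g).
have fM g : nrm (f g) <= M.
  by rewrite /M (bigD1 g) //= addrCA lerDl addr_ge0 // sumr_ge0 // => h _; exact: nrm_ge0.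
have M1 : 1 <= M by rewrite lerDl sumr_ge0 // => h _; exact: nrm_ge0.
pose N : R := #|gT|%:R; have N1 : 1 <= N := card_group_ge1 R gT.
(* Each of the [N] coefficients is a sum of [N] terms of norm at most [d * (1 + M)]. *)
pose d := eps / (2 * (N * N) * (1 + M)).
have d0 : 0 < d by rewrite divr_gt0 // !mulr_gt0 //; lra.
have dE : N * (N * (d * (1 + M))) = eps / 2 by rewrite /d; field; rewrite !gt_eqF //; lra.
have dN : N * (2 * d) <= eps / 2.
  rewrite -dE ler_pM2l; last lra.
  rewrite [leRHS]mulrCA mulrC ler_pM2l //.
  have : 1 + M <= N * (1 + M) by rewrite ler_peMl //; lra.
  lra.
have [pr [pp po /=]] := rokhlin_nrm (codom f) rok d0 px (positive0 A) x1.
have [] := sum_projection pp po; set p := \sum_g pr g => pproj pP [comm equiv _ pxp].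
have commf g h : nrm (pr g ** f h - f h ** pr g) <= d by rewrite ltW // comm ?codom_f.
have p1 : nrm p <= 1 := projection_nrm_le1 pproj.
have pr1 g : nrm (pr g) <= 1 := projection_nrm_le1 (pp g).
pose y := p ** x ** p; exists y.
pose z := \sum_g single 1%g (pr g) ** j f ** single 1%g (pr g); exists z.
have zE : z = \sum_h single h (\sum_g pr g ** f h ** alpha h (pr g)).
  rewrite /z; under eq_bigr do rewrite {1}sum_single cmul_sumr cmul_suml.
  rewrite exchange_big /=; apply: eq_bigr => h _; rewrite linear_sum.
  by apply: eq_bigr => g _; rewrite !single_mul mul1g mulg1 Defs.act1.
have y1 : nrm y <= 1.
  by rewrite -x1 (le_trans (nrm_mulr_le _ p1)) // nrm_mull_le.
split => //.
- by rewrite /self_adjoint /y !starM pproj.2 px.1 cmulA.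
- by apply: ideal_sum => g; apply: IMr; exact: IMl.
- have dN1 : d <= N * (2 * d) by rewrite (@le_trans _ _ (2 * d)) ?ler_peMl //; lra.
  by move: pxp; rewrite -/y; lra.
(* At the unit, only the cross terms between different Rokhlin projections are lost. *)
have diag : nrm (y - \sum_g pr g ** x ** pr g) <= N * (2 * d).
  have -> : y - \sum_g pr g ** x ** pr g =
      \sum_g (pr g ** x - x ** pr g) ** (p - pr g).
    rewrite /y {1}/p !cmul_suml -sumrB; apply: eq_bigr => g _.
    rewrite -cmulBr cmulBl -(cmulA x (pr g)) [pr g ** (p - _)]cmulBr.
    by rewrite pP (pp g).1 subrr cmul0r subr0.
  apply: nrm_sum_le => g; rewrite (le_trans (nrmM _ _)) // mulrC.
  apply: ler_pM; rewrite ?nrm_ge0 //; last exact: commf.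
  by have := nrmB p (pr g); have := pr1 g; move: p1; lra.
(* Away from the unit, [p_g] meets a projection close to [p_(h g)]. *)
have off h : h != 1%g ->
    nrm (single h (\sum_g pr g ** f h ** alpha h (pr g))) <= N * (d * (1 + M)).
  move=> h1; rewrite (le_trans (single_nrm_le _ _)) //; apply: nrm_sum_le => g.
  have -> : pr g ** f h ** alpha h (pr g) = (pr g ** f h - f h ** pr g) ** alpha h (pr g)
      + f h ** (pr g ** (alpha h (pr g) - pr (h * g)%g)).
    rewrite cmulBr po ?subr0; first by rewrite cmulBl !cmulA subrK.
    by rewrite -{1}[g]mul1g (inj_eq (mulIg g)) eq_sym.
  rewrite (le_trans (nrmD _ _)) // mulrDr mulr1 lerD //.
    rewrite (le_trans (nrmM _ _)) // act_nrm (le_trans _ (commf g h)) //.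
    by rewrite ler_piMr ?nrm_ge0.
  rewrite (le_trans (nrmM _ _)) // mulrC ler_pM ?nrm_ge0 //.
  rewrite (le_trans (nrmM _ _)) // (le_trans _ (ltW (equiv h g))) //.
  by rewrite ler_piMl ?nrm_ge0.
have E1 : \sum_g pr g ** f 1%g ** alpha 1%g (pr g) = \sum_g pr g ** x ** pr g.
  by apply: eq_bigr => g _; rewrite Defs.act1.
rewrite zE (bigD1 1%g) //= E1 opprD addrA -linearB.
rewrite (le_trans (nrmB _ _)) // (splitr eps) lerD //.
  by rewrite (le_trans (single_nrm_le _ _)) // (le_trans diag).
rewrite -dE big_mkcond /= nrm_sum_le // => h; case: eqP => [_|/eqP /off //] /=.
have N0 : 0 < N by lra.
by rewrite nrm0 -(pmulr_rge0 _ N0) dE divr_ge0 // ltW.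
Qed.

End Simple.

End CrossedProduct.

(** * Simplicity and separability of the crossed product *)
Section Simplicity.
Variables (R : realType) (A B : cstarAlgType R) (gT : finGroupType).
Variable alpha : cstar_action gT A.
Implicit Type P : {poly R}.

Lemma star_hom_poly_eval (D E : cstarAlgType R) (f : {linear D -> E}) P a :
  is_star_hom f -> f (poly_eval P a) = poly_eval P (f a).
Proof.
move=> [fM _]; rewrite /poly_eval linear_sum; apply: eq_bigr => i _.
rewrite linearZ /=; congr (_ *: _).
by elim: (i : nat) => //= n ih; rewrite fM ih.
Qed.

(** Powers of elements congruent modulo [I] are congruent. *)
Lemma ideal_poly_eval (D : cstarAlgType R) (I : set D) P a b :
  closed_ideal I -> I (a - b) -> I (poly_eval P a - poly_eval P b).
Proof.
move=> Iid; have [_ I0 IZ IMl IMr] := Iid; move=> Iab.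
have Ipow n : I (iter n (cmul a) a - iter n (cmul b) b).
  elim: n => //= n ih; have -> : a ** iter n (cmul a) a - b ** iter n (cmul b) b =
      1 *: (a ** (iter n (cmul a) a - iter n (cmul b) b)) + (a - b) ** iter n (cmul b) b.
    by rewrite cmulBr cmulBl scale1r addrA subrK.
  by apply: IZ; [exact: IMl|exact: IMr].
rewrite /poly_eval -sumrB; elim/big_ind: _ => // [x y Ix Iy|i _].
  by rewrite -[x]scale1r; exact: IZ.
by rewrite -scalerBr -[_ *: _]addr0; exact: IZ.
Qed.

Lemma is_funcalc_poly (D : cstarAlgType R) P (c : D) : P`_0 = 0 ->
  is_funcalc (fun t => P.[t]) c (poly_eval P c).
Proof.
move=> P0; apply/is_funcalcP => e e0; exists P; split => // [t _|].
  by rewrite subrr normr0 ltW.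
by rewrite subrr nrm0 ltW.
Qed.

(** Modulo [I] the square of [y] is congruent to a self-adjoint element [r] of norm at most 1/3,
    which [clamp] sends to 0; so [clamp] of the square of [y] is sent into [I] by [f]. It is nonzero,
    because the norm of the square exceeds 2/3 and belongs to its spectrum. *)
Lemma ideal_meets_image (f : {linear A -> B}) (I : set B) (y : A) (z : B) :
  is_star_hom f -> closed_ideal I -> self_adjoint y -> I z ->
  nrm y <= 1 -> 9 / 10 <= nrm y -> nrm (f y - z) <= 10^-1 ->
  exists2 a, a != 0 & I (f a).
Proof.
move=> fhom Iid sy Iz y1 y9 yz; have [fM fS] := fhom.
have [clI _ IZ IMl IMr] := Iid.
have fy1 : nrm (f y) <= 1 := le_trans (star_hom_nrm_le fhom y) y1.
have sfy : self_adjoint (f y) by rewrite /self_adjoint -fS sy.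
(* [z ** star z] is in the ideal like [z], and it is self-adjoint. *)
pose r := f (y ** y) - z ** star z.
have sr : self_adjoint r.
  by rewrite /self_adjoint starB -fS !starM sy starK.
have r3 : nrm r <= 3^-1.
  have z1 : nrm z <= 11 / 10 by have := nrm_sub_ge z (f y); rewrite nrm_distC; lra.
  have -> : r = (f y - z) ** f y + z ** star (f y - z).
    by rewrite starB sfy cmulBl cmulBr addrA subrK -fM.
  have k1 := le_trans (nrmM _ _) (ler_pM (nrm_ge0 _) (nrm_ge0 _) yz fy1).
  have yz' : nrm (star (f y - z)) <= 10^-1 by rewrite nrm_star.
  have k2 := le_trans (nrmM _ _) (ler_pM (nrm_ge0 _) (nrm_ge0 _) z1 yz').
  by rewrite (le_trans (nrmD _ _)) //; lra.
have syy : self_adjoint (y ** y) by rewrite /self_adjoint starM sy.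
have clamp0 : clamp (0 : R) = 0 by rewrite clampE invr_ge0 ler0n.
have cm := lipschitz_quad_modulus (@clamp_lipschitz R).
have [d yd] := funcalc_exists syy cm clamp0.
exists d.
  have [t yt tn] := spectral_radius_sa syy.
  have t0 : 0 <= t by have := (positive_sqr sy).2 _ yt; rewrite ler0c.
  have {tn}tE : t = nrm y ^+ 2 by rewrite -(ger0_norm t0) tn nrm_sa_sqr.
  have t23 : 2 / 3 <= t by rewrite tE; have := nrm_ge0 y; nra.
  have := funcalc_nrm_ge yd yt; rewrite clampE ifF; last by apply/negbTE; rewrite -ltNge; lra.
  rewrite t23 normr1; apply: contraTneq => ->; by rewrite nrm0 -ltNge.
apply: closed_nrmP clI _ => e e0.
have e30 : 0 < e / 3 by rewrite divr_gt0.
have [P [P0 Pc]] := weierstrass 1 cm clamp0 e30.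
exists (f (poly_eval P (y ** y)) - poly_eval P r).
  rewrite star_hom_poly_eval //; apply: ideal_poly_eval => //.
  by rewrite /r subKr; exact: IMr.
have yy1 : nrm (y ** y) <= 1 by rewrite nrm_sa_sqr // expr_le1 ?nrm_ge0.
have k1 : nrm (f (d - poly_eval P (y ** y))) <= e / 3.
  rewrite (le_trans (star_hom_nrm_le fhom _)) //.
  apply: (funcalc_dist syy yd (is_funcalc_poly _ P0)) => t /spectrum_bound yt.
  by rewrite distrC Pc // (le_trans yt).
have k2 : nrm (poly_eval P r) <= e / 3.
  apply: nrm_poly_eval_le => // t /spectrum_bound rt; have tr := le_trans rt r3.
  have := Pc t; rewrite clampE (le_trans (ler_norm t) tr) subr0; apply.
  by rewrite (le_trans tr) // invf_le1 ?ler1n.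
have -> : f d - (f (poly_eval P (y ** y)) - poly_eval P r) =
    f (d - poly_eval P (y ** y)) + poly_eval P r by rewrite (linearB f); module_ring.
by rewrite (le_lt_trans (nrmD _ _)) //; lra.
Qed.

(** A nonzero ideal comes within 1/10 of an element of [A] of norm at least 9/10, hence
    contains a nonzero element of [A], hence everything. *)
Lemma crossed_product_simple : cstar_simple A -> tracial_rokhlin alpha ->
  crossed_product alpha B -> cstar_simple B.
Proof.
move=> sA rok [j [j_bij jM jS]]; split=> [|I Iid].
  have [[a a0] _] := sA; exists (single j 1%g a).
  by apply: contraNneq a0 => j0; apply/eqP/(single_inj j_bij (g := 1%g)); rewrite j0 linear0.
have [nI|zI] := pselect (exists2 b, b != 0 & I b); last first.
  left; apply/seteqP; split=> [b Ib|b ->] /=; last by case: Iid.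
  by apply/eqP; apply: contrapT => /negP b0; apply: zI; exists b.
right; have [f [If px x1]] := ideal_unit_coefficient j_bij jM Iid nI.
have e0 : 0 < 10^-1 :> R by rewrite invr_gt0.
have [y [z [sy Iz y1 y9 yz]]] := rokhlin_average jM jS Iid rok e0 If px x1.
apply: (ideal_setT j_bij jM jS sA Iid).
apply: (ideal_meets_image (single1_is_star_hom jM jS) Iid sy Iz y1 _ yz).
by move: y9; lra.
Qed.

Lemma countable_dense_range (D : set A) : countable D ->
  exists d : nat -> A, D `<=` range d.
Proof.
move=> /pcard_injP [f p]; exists (fun n => xget 0 [set a | D a /\ f a = n]) => a Da.
exists (f a) => //; case: xgetP => [b _ [Db fb]|/(_ a)/(_ (conj Da erefl)) //].
by apply: p => //; rewrite inE.
Qed.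

(** Functions on the group with values in a countable dense set are countably many and dense,
    as each coefficient is carried to the crossed product without increase of norm. *)
Lemma crossed_product_separable : crossed_product alpha B -> separable A ->
  separable B.
Proof.
move=> [j [j_bij jM jS]] [D cD dD]; have [d Dd] := countable_dense_range cD.
pose F (phi : {ffun gT -> nat}) := j [ffun g => d (phi g)].
exists (range F).
  by apply: sub_countable (card_image_le _ _) _; exact: countableP.
move=> O [b Ob] opO; have [e /= e0 eO] : exists2 e : R[i], 0 < e & ball b e `<=` O.
  by have /nbhs_ballP := open_nbhs_nbhs (conj opO Ob).
have [e0' eE] := norm_lt_Re B e0.
have [j' _ jK] := j_bij; pose f := j' b.
pose N : R := #|gT|%:R + 1; have N0 : 0 < N by rewrite ltr_wpDl.
have dist g : exists n, nrm (f g - d n) < complex.Re e / N.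
  have [|a [/= fa /Dd[n _ na]]] := dD (ball (f g) (complex.Re e / N)%:C) _ (ball_open _ _).
    by exists (f g); apply: ballxx; rewrite ltcR divr_gt0.
  by exists n; move: fa; rewrite na -ball_normE /= nrmE ltcR.
have /(_ _)/cid-phi := dist; pose psi := [ffun g => sval (phi g)] : {ffun gT -> nat}.
exists (F psi); split; last by exists psi.
apply: eO; rewrite -ball_normE /= eE.
have -> : b - F psi = \sum_g single j g (f g - d (psi g)).
  rewrite -[b]jK /F -linearB sum_single; apply: eq_bigr => g _.
  by rewrite !ffunE.
apply: (@le_lt_trans _ _ (#|gT|%:R * (complex.Re e / N))).
  apply: nrm_sum_le => g; rewrite (le_trans (single_nrm_le jM jS _ _)) // ffunE.
  exact: ltW (svalP (phi g)).
by rewrite mulrCA gtr_pMr // ltr_pdivrMr // mul1r ltrDl.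
Qed.

End Simplicity.

(** * The crossed product of a corner *)

Section CornerCrossedProduct.
Variables (R : realType) (A B : cstarAlgType R) (gT : finGroupType).
Variables (alpha : cstar_action gT A) (q : projection A).
Hypothesis alpha_q : forall g, alpha g (q : A) = (q : A).

(** Compressing the element with coefficients [f g] by the image of [q] compresses each
    coefficient, because [q] is invariant. *)
Lemma corner_crossed_product : crossed_product alpha B ->
  exists Q : projection B, (proj_val q <> 0 -> proj_val Q <> 0) /\
    crossed_product (corner_action alpha_q) (corner Q).
Proof.
move=> [j [j_bij jM jS]]; have [qq sq] := projP q.
have [iM iS] := single1_is_star_hom jM jS.
have Qp : is_projection (single j 1%g q) by split; rewrite -?iM -?iS ?qq ?sq.
pose Q := Projection Qp; exists Q; split.
  by move=> q0 Q0; apply: q0; apply: (single_inj j_bij (g := 1%g)); rewrite linear0.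
pose ext (f : {ffun gT -> corner q}) : {ffun gT -> A} := [ffun g => val (f g)].
have QfQ (f : {ffun gT -> A}) :
    Q ** j f ** Q = j [ffun g => q ** f g ** q].
  rewrite !sum_single cmul_sumr cmul_suml; apply: eq_bigr => g _.
  by rewrite !(single_mul jM) mul1g mulg1 Defs.act1 alpha_q ffunE.
have jext f : j (ext f) \in corner_pred Q.
  apply/eqP; rewrite QfQ; congr (j _); apply/ffunP => g.
  by rewrite !ffunE corner_mull corner_mulr.
pose j' f : corner Q := Corner (jext f).
have j'_lin : linear j'.
  move=> l f h; apply: val_inj; rewrite /= -linearP; congr (j _).
  by apply/ffunP => g; rewrite !ffunE.
exists (HB.pack_for {linear {ffun gT -> corner q} -> corner Q} j'
  (GRing.isLinear.Build R[i] _ _ _ j' j'_lin)); split.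
- have [k kj jk] := j_bij.
  exists (fun b => [ffun g => compress q (k (val b) g)]) => [f|b].
    by apply/ffunP => g; rewrite ffunE /= kj ffunE compress_val.
  have bE : Q ** val b ** Q = val b by rewrite corner_mull corner_mulr.
  apply: val_inj; rewrite /= -[RHS]bE -[in RHS](jk (val b)) QfQ.
  by congr (j _); apply/ffunP => g; rewrite !ffunE.
- move=> f h; apply: val_inj; rewrite /= -jM; congr (j _); apply/ffunP => g.
  rewrite !ffunE (big_morph val (id1 := 0) (op1 := +%R)) //.
  by apply: eq_bigr => k _; rewrite !ffunE.
- move=> f; apply: val_inj; rewrite /= -jS; congr (j _); apply/ffunP => g.
  by rewrite !ffunE.
Qed.

End CornerCrossedProduct.

Theorem proposition3p2 (R : realType) (gT : finGroupType)
  (sep : bool)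
  (C : cstarAlgType R -> Prop)
  (C_simple : forall A : cstarAlgType R,
    C A -> cstar_simple A /\ (sep -> separable A))
  (C_corner : forall (A : cstarAlgType R) (p : projection A),
    cstar_simple A -> (sep -> separable A) -> proj_val p <> 0 ->
    (C A <-> C (corner p)))
  (C_unital_crossed : forall (A : cstarAlgType R) (alpha : cstar_action gT A),
    C A -> unital A -> tracial_rokhlin alpha ->
    forall B : cstarAlgType R, crossed_product alpha B -> C B)
  (C_iso : forall A B : cstarAlgType R, C A -> cstar_iso A B -> C B)
  (A : cstarAlgType R) (alpha : cstar_action gT A) :
  C A -> tracial_rokhlin alpha ->
  forall B : cstarAlgType R, crossed_product alpha B -> C B.
Proof.
move=> CA rok B cB; have [sA sepA] := C_simple A CA; have [a_ex _] := sA.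
have [q [qp q0 alpha_q]] := invariant_projection rok a_ex.
pose p := Projection qp; have p0 : proj_val p <> 0 by apply/eqP.
have [Q [Q0 cQ]] := @corner_crossed_product _ _ _ _ _ p alpha_q cB.
have Cp : C (corner p) by apply/(C_corner A p sA sepA p0).
have up : unital (corner p).
  exists (compress p p) => a.
  split; apply: val_inj; have [pp _] := projP p; rewrite /= pp pp.
    exact: corner_mull.
  exact: corner_mulr.
apply/(C_corner B Q _ _ (Q0 p0)).
- exact: crossed_product_simple sA rok cB.
- by move=> /sepA; exact: crossed_product_separable cB.
- exact: C_unital_crossed _ _ Cp up (corner_rokhlin (q := p) alpha_q rok) _ cQ.
Qed.
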